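(* There are uncountably many distinct homeomorphism types of endpoint-homogeneous smooth fans.
   Context: A continuum is a nonempty compact connected metric space. A continuum is unicoherent if whenever it is the union of two subcontinua $A,B$, the set $A\cap B$ is connected; it is hereditarily unicoherent if every subcontinuum is unicoherent. A dendroid is an arcwise connected, hereditarily unicoherent continuum. In a dendroid $D$, any two distinct points $x,y$ are the endpoints of exactly one arc, denoted $[x,y]$ (and $[x,x]=\{x\}$). A point of $D$ is an endpoint of $D$ if it is an endpoint of every arc in $D$ that contains it; $E(D)$ denotes the set of endpoints. A ramification point of $D$ is the common point (top) of some simple triod contained in $D$ (a simple triod is three arcs glued together at one endpoint). A fan is a dendroid with exactly one ramification point $t$, called its top. A fan $F$ with top $t$ is smooth if for every convergent sequence $(x_n)$ in $F$, $\lim_{n\to\infty}[t,x_n]=[t,\lim_{n\to\infty} x_n]$ in the Hausdorff metric. A fan $F$ is endpoint-homogeneous if for any $e,e'\in E(F)$ there is a homeomorphism $h:F\to F$ with $h(e)=e'$. *)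

(* Defs.v *)
From HB Require Import structures.
From mathcomp Require Import all_boot all_order all_algebra.
From mathcomp Require Import all_classical all_reals all_analysis.

Set Implicit Arguments.
Unset Strict Implicit.
Unset Printing Implicit Defensive.

Import Order.TTheory GRing.Theory Num.Theory.
Import numFieldNormedType.Exports.
Local Open Scope classical_set_scope.
Local Open Scope ring_scope.

Definition homeomorphism (X Y : topologicalType) (h : X -> Y) : Prop :=
  exists g : Y -> X,
    [/\ cancel h g, cancel g h, continuous h & continuous g].

Definition homeomorphic (X Y : topologicalType) : Prop :=
  exists h : X -> Y, homeomorphism h.

Section Subsets.
Context {R : realType} {X : metricType R}.
Implicit Types (A B K : set X) (x y t e : X).

Definition is_continuum K : Prop := [/\ K !=set0, compact K & connected K].

Definition unicoherent K : Prop := forall A B,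
  is_continuum A -> is_continuum B -> A `|` B = K -> connected (A `&` B).

(* [g] is the inverse of [f], so that [A] is homeomorphic to the interval. *)
Definition arc_between A x y : Prop :=
  exists (f : R -> X) (g : X -> R),
    [/\ f @` `[0, 1] = A,
        {within `[0, 1], continuous f},
        {within A, continuous g},
        {in `[0, 1], cancel f g} &
        f 0 = x /\ f 1 = y].

(* [the_arc x y] is the arc [x, y] when there is exactly one arc from [x] to
   [y], as in a dendroid; it is unspecified when there are several. *)
Definition the_arc x y : set X :=
  if x == y then [set x] else xget set0 [set A | arc_between A x y].

Definition is_endpoint e : Prop := forall A x y,
  arc_between A x y -> A e -> e = x \/ e = y.

Definition simple_triod_top t : Prop := exists (A B C : set X) (a b c : X),
  [/\ [/\ arc_between A t a, arc_between B t b & arc_between C t c],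
      A `&` B = [set t], A `&` C = [set t] & B `&` C = [set t]].

Definition hausdorff_dist A B : \bar R :=
  maxe (ereal_sup [set edist_inf B x | x in A])
       (ereal_sup [set edist_inf A x | x in B]).

End Subsets.

Section Spaces.
Context {R : realType}.
Implicit Type X : metricType R.

Definition arcwise_connected X : Prop := forall x y : X,
  x != y -> exists A : set X, arc_between A x y.

Definition hereditarily_unicoherent X : Prop := forall K : set X,
  is_continuum K -> unicoherent K.

Definition dendroid X : Prop :=
  [/\ is_continuum [set: X], arcwise_connected X & hereditarily_unicoherent X].

Definition fan_with_top X (t : X) : Prop :=
  dendroid X /\ [set s : X | simple_triod_top s] = [set t].

Definition smooth_at X (t : X) : Prop := forall (u : nat -> X) (x : X),
  u n @[n --> \oo] --> x ->
  hausdorff_dist (the_arc t (u n)) (the_arc t x) @[n --> \oo] --> 0%E.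

Definition smooth_fan X : Prop :=
  exists t : X, fan_with_top t /\ smooth_at t.

Definition endpoint_homogeneous X : Prop := forall e e' : X,
  is_endpoint e -> is_endpoint e' ->
  exists h : X -> X, homeomorphism h /\ h e = e'.

End Spaces.

(* Main.v *)
From HB Require Import structures.
Require Import Defs.
From mathcomp Require Import all_boot all_order all_algebra.
From mathcomp Require Import all_classical all_reals all_analysis.
From mathcomp Require Import zify ring lra.

Set Implicit Arguments.
Unset Strict Implicit.
Unset Printing Implicit Defensive.

Import Order.TTheory GRing.Theory Num.Theory.
Import numFieldNormedType.Exports.
Local Open Scope classical_set_scope.
Local Open Scope ring_scope.

(** Every set [M] of naturals gives a fan, and [M] can be read off its topology.

The legs of the fan are indexed by finite words over pairs [(m, n)], the empty
word included.  A point is a pair of a word and a height, all points of height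
[0] being identified with the top.  The topology is that of the coordinates:
for each word [u], the height of the point if its leg extends [u] and [0]
otherwise.  Thus a leg [w] is the limit, as [n] grows, of the legs whose words
extend [rcons w (m, n)].

Let [cost w] be the sum of the [m + 1] over the letters [(m, n)] of [w].  The
leg [rcons w (m, n)] has length [2^-(cost w + 1)], whatever [m] and [n] are.
Hence, away from the top, the endpoints of the fan cluster on the leg [w]
exactly at the heights [2^-(cost w + j + 1)], with [j] a natural number.  The
choice of [m] only matters to what follows: the highest cluster point of the
leg [rcons w (m, n)] is at height [2^-(cost w + m + 2)], level with the cluster
point of [w] that comes [m + 1] places after the highest one.  The letters
allowed are those with [m = 0] or [m - 1] in [M].

- The space is compact because lengths tend to [0] along an infinite branch of
  the tree of words ([fan_compact]).  A subcontinuum contains, with two points,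
  the segment joining them ([continuum_convex]).  So arcs are segments,
  subcontinua are the closed convex sets, and intersections of convex sets are
  convex, hence connected.  Multiplying heights by a scalar in [0, 1] does not
  increase distances, which gives smoothness.
- The legs extending a nonempty word [w] form a copy of the whole fan, with
  heights shrunk; the other legs form a copy too, because removing one term
  from an infinite sequence of similar subfans changes nothing.  Exchanging the
  two copies is a homeomorphism that takes the endpoint of the root leg to that
  of [w] ([swap_fan]), so all endpoints are alike.
- A homeomorphism preserves the top, the only top of a triod, and the order
  along legs, which is defined by subcontinua; so it preserves the list of
  cluster points of every leg from the endpoint down.  It remains to observe
  that [m] is allowed if and only if there are endpoints that converge to the
  highest cluster point of a leg while the highest cluster points of their own
  legs converge to the cluster point [m + 1] places after it
  ([clusters_jumpP]).

There are uncountably many sets [M], by Cantor's diagonal argument. *)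

(** * The tree of legs *)

Definition word := seq (nat * nat).

Implicit Types (u v w : word) (M : pred nat).

(** Letters with [m = 0] are always allowed: they make endpoints cluster at every
    height [2^-(cost w + j + 1)] of a leg [w], which makes all legs alike. *)
Definition allowed M m := (m == 0%N) || M m.-1.

Definition admissible M w := all (fun a => allowed M a.1) w.

(** The leg [w] carries cluster points of endpoints at the heights
    [2^-(cost w + j + 1)]. *)
Definition cost w := sumn [seq a.1.+1 | a <- w].

(** The leg [w] has length [2^-(depth w)].  Subtracting the last [m] makes the
    length of a child of [w] depend on [w] only (see [depth_rcons]), so that the
    endpoints of all the children of [w] are at the same height. *)
Definition depth w := (cost w - (last (0, 0) w).1)%N.

Lemma cost_cat w v : cost (w ++ v) = (cost w + cost v)%N.
Proof. by rewrite /cost map_cat sumn_cat. Qed.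

Lemma cost_rcons w a : cost (rcons w a) = (cost w + a.1.+1)%N.
Proof. by rewrite -cats1 cost_cat /cost /= addn0. Qed.

Lemma size_le_cost w : (size w <= cost w)%N.
Proof. by rewrite /cost; elim: w => //= a w IH; lia. Qed.

Lemma depth_rcons w a : depth (rcons w a) = (cost w).+1.
Proof. rewrite /depth cost_rcons last_rcons; lia. Qed.

Lemma depth_cat w v : v != [::] -> depth (w ++ v) = (cost w + depth v)%N.
Proof.
by case/lastP: v => // v a _; rewrite -rcons_cat !depth_rcons cost_cat addnS.
Qed.

Lemma depth_le_cost w : (depth w <= cost w)%N.
Proof. exact: leq_subr. Qed.

Lemma size_le_depth w : (size w <= depth w)%N.
Proof.
case/lastP: w => // w a; rewrite depth_rcons size_rcons ltnS; exact: size_le_cost.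
Qed.

Lemma depth_catl w v : (depth w <= depth (w ++ v))%N.
Proof.
have [->|v0] := eqVneq v [::]; first by rewrite cats0.
by rewrite (depth_cat _ v0); have := depth_le_cost w; lia.
Qed.

Lemma prefix_linear u v w : prefix u w -> prefix v w -> prefix u v || prefix v u.
Proof.
move=> /prefixP[u' ->]; elim: u v u' => [|a u IH] [|b v] u' //=; rewrite ?prefix0s //.
by move=> /andP[/eqP-> /IH]; rewrite eqxx.
Qed.

Lemma prefix_anti u v : prefix u v -> prefix v u -> u = v.
Proof.
move=> uv vu; have vu_size := size_prefix vu.
by move: uv; rewrite prefixE take_oversize// => /eqP.
Qed.

(** * The space *)

Section Length.
Context {R : realType} (M : pred nat).

Definition leg_len w : R := if admissible M w then 2^-1 ^+ depth w else 0.

Lemma len_ge0 w : 0 <= leg_len w.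
Proof. by rewrite /leg_len; case: ifP => // _; rewrite exprn_ge0. Qed.

Lemma len_gt0 w : (0 < leg_len w) = admissible M w.
Proof. by rewrite /leg_len; case: ifP; rewrite ?ltxx// => _; rewrite exprn_gt0. Qed.

Lemma pow2_le (m n : nat) : (m <= n)%N -> (2^-1 ^+ n <= 2^-1 ^+ m :> R).
Proof. by move=> mn; apply: ler_wiXn2l => //; lra. Qed.

Lemma len_le_pow w : leg_len w <= 2^-1 ^+ size w.
Proof.
rewrite /leg_len; case: ifP => _; last by rewrite exprn_ge0.
exact/pow2_le/size_le_depth.
Qed.

Lemma len_le1 w : leg_len w <= 1.
Proof. by apply: le_trans (len_le_pow w) _; rewrite -(expr0 2^-1) pow2_le. Qed.

Lemma len_prefix u w : prefix u w -> leg_len w <= leg_len u.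
Proof.
move=> /prefixP[v ->]; have := len_ge0 u; rewrite /leg_len /admissible all_cat.
case: (all _ u) => //= ?; case: (all _ v) => //=.
exact/pow2_le/depth_catl.
Qed.

(** Height [0] is only allowed on the root leg: this is how the bottoms of all legs
    become one point, the top of the fan. *)
Definition on_leg (p : word * R) :=
  (0 <= p.2 <= leg_len p.1) && ((p.2 == 0) ==> (p.1 == [::])).

End Length.

Definition fan (R : realType) (M : pred nat) : Type := {p : word * R | on_leg M p}.

HB.instance Definition _ R M := SubType.on (fan R M).
HB.instance Definition _ R M := Choice.on (fan R M).

Section Fan.
Context {R : realType} {M : pred nat}.
Local Notation X := (fan R M).
Local Notation len := (@leg_len R M).
Implicit Types (p q z : X).

Definition leg p : word := (val p).1.
Definition ht p : R := (val p).2.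

Lemma ht_ge0 p : 0 <= ht p.
Proof. by have /andP[/andP[]] := valP p. Qed.

Lemma ht_le p : ht p <= len (leg p).
Proof. by have /andP[/andP[]] := valP p. Qed.

Lemma ht_le1 p : ht p <= 1.
Proof. exact: le_trans (ht_le p) (len_le1 _ _). Qed.

Lemma leg_ht0 p : ht p = 0 -> leg p = [::].
Proof.
by have /andP[_ /implyP h] := valP p => /eqP/h/eqP.
Qed.

Lemma fan_eq p q : leg p = leg q -> ht p = ht q -> p = q.
Proof.
rewrite /leg /ht => lE hE; apply: val_inj.
by rewrite [val p]surjective_pairing [val q]surjective_pairing lE hE.
Qed.

(** The map from points to families of coordinates embeds the fan in a product of
    intervals; this is what the topology is built from. *)
Definition coord u p : R := if prefix u (leg p) then ht p else 0.

Lemma coord_ge0 u p : 0 <= coord u p.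
Proof. by rewrite /coord; case: ifP => // _; exact: ht_ge0. Qed.

Lemma coord_le1 u p : coord u p <= 1.
Proof. by rewrite /coord; case: ifP => // _; exact: ht_le1. Qed.

Lemma coord_nil p : coord [::] p = ht p.
Proof. by rewrite /coord prefix0s. Qed.

Lemma coord_gt0 u p : (0 < coord u p) = prefix u (leg p) && (0 < ht p).
Proof. by rewrite /coord; case: ifP => //=; rewrite ltxx. Qed.

Lemma coord_inj p q : (forall u, coord u p = coord u q) -> p = q.
Proof.
move=> h; have hh : ht p = ht q by have := h [::]; rewrite !coord_nil.
have [p0|p0] := eqVneq (ht p) 0.
  by apply: fan_eq => //; rewrite !leg_ht0 // -hh.
apply: fan_eq => //; apply: prefix_anti.
  by apply: contraNT p0 => n; have := h (leg p); rewrite /coord prefix_refl (negbTE n) => ->.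
apply: contraNT p0 => n; have := h (leg q).
by rewrite /coord prefix_refl (negbTE n) -hh => <-.
Qed.

(** Dividing by [(pickle u).+1] leaves only finitely many coordinates visible at
    a given scale, so the supremum metrizes coordinatewise convergence. *)
Definition wdist p q u : R := `|coord u p - coord u q| / (pickle u).+1%:R.

Definition fdist p q : R := sup (range (wdist p q)).

Lemma wdist_le_coord p q u : wdist p q u <= `|coord u p - coord u q|.
Proof. by rewrite ler_pdivrMr// ler_peMr// ler1n. Qed.

Lemma coordB_le1 p q u : `|coord u p - coord u q| <= 1.
Proof.
have := coord_ge0 u p; have := coord_ge0 u q; have := coord_le1 u p; have := coord_le1 u q.
by move=> *; rewrite ler_norml; apply/andP; split; lra.
Qed.

Lemma wdist_le p q u : wdist p q u <= fdist p q.
Proof.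
apply: ub_le_sup; last by exists u.
exists 1 => _ [v _ <-]; exact: le_trans (wdist_le_coord _ _ _) (coordB_le1 _ _ _).
Qed.

Lemma fdist_le p q (e : R) : (forall u, wdist p q u <= e) -> fdist p q <= e.
Proof.
by move=> h; apply: ge_sup; [exists (wdist p q [::]); exists [::]|move=> _ [u _ <-]].
Qed.

Lemma fdist_ge0 p q : 0 <= fdist p q.
Proof. by apply: le_trans (wdist_le p q [::]); rewrite divr_ge0. Qed.

Lemma fdistxx p : fdist p p = 0.
Proof.
apply/eqP; rewrite eq_le fdist_ge0 andbT; apply: fdist_le => u.
by rewrite /wdist subrr normr0 mul0r.
Qed.

Lemma fdist_sym p q : fdist p q = fdist q p.
Proof.
rewrite /fdist; have -> // : wdist p q = wdist q p.
by apply/funext => u; rewrite /wdist distrC.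
Qed.

Lemma fdist_tri q p z : fdist p z <= fdist p q + fdist q z.
Proof.
apply: fdist_le => u; apply: le_trans (lerD (wdist_le p q u) (wdist_le q z u)).
rewrite -mulrDl ler_pM2r ?invr_gt0//.
by apply: le_trans (ler_normD _ _); rewrite addrA subrK.
Qed.

Lemma fdist_coord p q u : `|coord u p - coord u q| <= (pickle u).+1%:R * fdist p q.
Proof. by have := wdist_le p q u; rewrite ler_pdivrMr// mulrC. Qed.

Lemma fdist_pos p q : fdist p q = 0 -> p = q.
Proof.
move=> h; apply: coord_inj => u; apply/eqP; rewrite -subr_eq0 -normr_le0.
by rewrite (le_trans (fdist_coord p q u))// h mulr0.
Qed.

Definition fball p (e : R) : set X := [set q | fdist p q < e].

Lemma fball_center p (e : R) : 0 < e -> fball p e p.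
Proof. by move=> e0; rewrite /fball /= fdistxx. Qed.

Lemma fball_sym p q (e : R) : fball p e q -> fball q e p.
Proof. by rewrite /fball /= fdist_sym. Qed.

Lemma fball_triangle p q z (d e : R) :
  fball p d q -> fball q e z -> fball p (d + e) z.
Proof.
by move=> pq qz; apply: le_lt_trans (fdist_tri q p z) _; rewrite ltrD.
Qed.

Definition fent : set_system (X * X) := entourage_ fball.

(** Locked, so that neighborhoods are not unfolded into balls by unification. *)
Fact fnbhs_key : unit. Proof. by []. Qed.
Definition fnbhs : X -> set_system X := locked_with fnbhs_key (nbhs_ fent).

Lemma fnbhsE : fnbhs = nbhs_ fent.
Proof. by rewrite /fnbhs unlock. Qed.

HB.instance Definition _ := hasNbhs.Build X fnbhs.
HB.instance Definition _ := @Nbhs_isPseudoMetric.Build R X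
  fent fnbhsE fball fball_center fball_sym fball_triangle erefl.
HB.instance Definition _ := @PseudoMetric_isMetric.Build R X
  fdist fdist_ge0 fdist_pos (fun _ _ => erefl).
End Fan.
Arguments fan_eq {R M p q}.

(** * Points, convergence and compactness *)

Section Points.
Context {R : realType} {M : pred nat}.
Local Notation X := (fan R M).
Local Notation len := (@leg_len R M).
Implicit Types (p q z : X) (s : R).

Lemma top_subproof : on_leg M ([::], 0 : R).
Proof. by rewrite /on_leg /= lexx len_ge0 eqxx. Qed.

Definition top : X := Sub _ top_subproof.

(** The height is clamped to the leg, which makes [pt w] a total function, and a
    continuous one, of a real number. *)
Definition pt w s : X := insubd top (w, Num.min s (len w)).

Lemma ht_top : ht top = 0. Proof. by rewrite /ht SubK. Qed.

Lemma leg_top : leg top = [::]. Proof. by rewrite /leg SubK. Qed.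

Lemma ht_eq0 p : (ht p == 0) = (p == top).
Proof.
apply/eqP/eqP => [h|->]; last exact: ht_top.
by apply: fan_eq; rewrite ?leg_top ?ht_top // leg_ht0.
Qed.

Lemma ht_gt0 p : (0 < ht p) = (p != top).
Proof. by rewrite lt_neqAle ht_ge0 andbT eq_sym ht_eq0. Qed.

Lemma ptE w s : 0 < s <= len w -> leg (pt w s) = w /\ ht (pt w s) = s.
Proof.
move=> /andP[s0 sw]; rewrite /leg /ht val_insubd /= min_l//.
by rewrite /on_leg /= (ltW s0) sw gt_eqF.
Qed.

Lemma ht_pt w s : ht (pt w s) = Num.max 0 (Num.min s (len w)).
Proof.
rewrite /ht val_insubd /on_leg /= ge_min lexx orbT andbT.
have [h0|h0] /= := lerP 0 (Num.min s (len w)); last exact: ht_top.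
have [e|_] //= := eqVneq (Num.min s (len w)) 0.
by case: ifP => //= _; rewrite ?e // ht_top.
Qed.

Lemma pt_top w s : s <= 0 -> pt w s = top.
Proof. by move=> s0; apply/eqP; rewrite -ht_eq0 ht_pt max_l ?ge_min ?s0. Qed.

Lemma pt_id p : pt (leg p) (ht p) = p.
Proof.
have [p0|p0] := eqVneq p top; first by rewrite p0 ht_top pt_top.
by have [] := @ptE (leg p) (ht p); rewrite ?ht_gt0 ?p0 ?ht_le//; apply: fan_eq.
Qed.

Lemma coord_pt u w s :
  coord u (pt w s) = if prefix u w then Num.max 0 (Num.min s (len w)) else 0.
Proof.
rewrite /coord ht_pt; have [h0|h0] := lerP (Num.min s (len w)) 0.
  by rewrite !if_same.
rewrite /leg /pt val_insubd /= /on_leg /= (ltW h0) ge_min lexx orbT.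
by rewrite (gt_eqF h0).
Qed.

End Points.
Arguments top {R M}.

Section Topology.
Context {R : realType} {M : pred nat}.
Local Notation X := (fan R M).
Local Notation len := (@leg_len R M).
Implicit Types (p q z : X).

Lemma pow2_small (x : R) : 0 < x -> exists n, 2^-1 ^+ n < x.
Proof.
move=> x0; exists (Num.bound x^-1); rewrite exprVn -[ltRHS]invrK ltf_pV2.
- apply: lt_le_trans (archi_boundP _) _; first by rewrite invr_ge0 ltW.
  by rewrite -natrX ler_nat ltnW// ltn_expl.
- by rewrite posrE exprn_gt0.
- by rewrite posrE invr_gt0.
Qed.

Lemma near_all_lt {T} (F : set_system T) {FF : Filter F} (P : nat -> T -> Prop) :
  (forall k, \forall x \near F, P k x) ->
  forall n, \forall x \near F, forall k, (k < n)%N -> P k x.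
Proof.
move=> h; elim=> [|n IH]; first exact: nearW.
near=> x => k; rewrite ltnS leq_eqVlt => /orP[/eqP->|]; first by near: x; exact: h.
by move: k; near: x.
Unshelve. all: by end_near. Qed.

(** All but finitely many coordinates weigh less than any given [e], and each of
    the others is eventually small. *)
Lemma cvg_coord {T} (F : set_system T) {FF : Filter F} (f : T -> X) q :
  f @ F --> q <-> forall u, coord u (f x) @[x --> F] --> coord u q.
Proof.
split=> [fq u|fq].
  apply/cvgrPdist_lt => e e0.
  have e1 : 0 < e / (pickle u).+1%:R by rewrite divr_gt0.
  have := @metricType_numDomainType.cvgr_dist_lt _ _ _ _ FF f q fq _ e1.
  apply: filterS => x /=; rewrite ltr_pdivlMr// mulrC; apply: le_lt_trans.
  exact: fdist_coord.
apply/metricType_numDomainType.cvgrPdist_lt => e e0.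
pose n := Num.bound (2 / e).
have hn : forall k, (n <= k)%N -> k.+1%:R^-1 <= e / 2.
  move=> k nk; rewrite -[leRHS]invrK lef_pV2 ?posrE ?invr_gt0 ?divr_gt0//.
  rewrite invf_div; apply: ltW; apply: lt_le_trans (archi_boundP _) _.
    by rewrite divr_ge0// ltW.
  by rewrite ler_nat leqW.
have near_u k : \forall x \near F, forall u, pickle u = k ->
    `|coord u q - coord u (f x)| <= e / 2.
  case E : (unpickle k : option word) => [v|]; last first.
    by apply: nearW => x u uk; move: E; rewrite -uk pickleK.
  have e2 : 0 < e / 2 by rewrite divr_gt0.
  have /cvgrPdist_le /(_ _ e2) := fq v.
  by apply: filterS => x h u uk; move: E; rewrite -uk pickleK => -[->].
apply: filterS (near_all_lt near_u n) => x h.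
apply: (@le_lt_trans _ _ (e / 2)); last by rewrite ltr_pdivrMr// ltr_pMr// ltr1n.
apply: fdist_le => u; have [un|nu] := ltnP (pickle u) n.
  exact: le_trans (wdist_le_coord _ _ _) (h _ un u erefl).
apply: le_trans (hn _ nu); rewrite /wdist ler_piMl ?invr_ge0//.
exact: coordB_le1.
Qed.

Lemma coord_continuous u : continuous (coord u : X -> R).
Proof. by move=> q; have /(@cvg_coord _ (nbhs q) _ id) := @cvg_id _ (nbhs q); apply. Qed.

Lemma ht_continuous : continuous (ht : X -> R).
Proof.
have -> : (ht : X -> R) = coord [::] by apply/funext => p; rewrite coord_nil.
exact: coord_continuous.
Qed.

Lemma cvg_top {T} (F : set_system T) {FF : Filter F} (f : T -> X) :
  ht (f x) @[x --> F] --> (0 : R) -> f @ F --> (top : X).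
Proof.
move=> h; apply/cvg_coord => u; apply/cvgrPdist_lt => e e0.
have /cvgrPdist_lt/(_ e e0) := h; apply: filterS => x.
rewrite /coord ht_top if_same; case: ifP => // _.
by rewrite subrr normr0.
Qed.

(** The coordinate [u] is either [0] or the height, and the height stays away from
    [0] near [q]: so the legs that extend [u] form a clopen set off the top. *)
Lemma near_leg u q : q != top -> \forall p \near q, prefix u (leg p) = prefix u (leg q).
Proof.
rewrite -ht_gt0 => q0; have h2 : 0 < ht q / 2 by rewrite divr_gt0.
have /cvgrPdist_lt/(_ _ h2) h1 := @ht_continuous q.
have /cvgrPdist_lt/(_ _ h2) hu := @coord_continuous u q.
near=> p.
have : `|ht q - ht p| < ht q / 2 by near: p.
have : `|coord u q - coord u p| < ht q / 2 by near: p.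
rewrite /coord !ltr_norml => /andP[A B] /andP[C D].
by move: A B; case: (prefix u (leg p)); case: (prefix u (leg q)) => // *; lra.
Unshelve. all: by end_near. Qed.

Lemma cvg_leg {T} (F : set_system T) {FF : Filter F} (f : T -> X) q :
  ht (f x) @[x --> F] --> ht q ->
  (forall u, \forall x \near F, prefix u (leg (f x)) = prefix u (leg q)) ->
  f @ F --> q.
Proof.
move=> hh hu; apply/cvg_coord => u; rewrite {2}/coord.
have {hu} hu := hu u; have [uq|uq] := boolP (prefix u (leg q)).
  apply: cvg_trans hh; apply: near_eq_cvg; apply: filterS hu => x.
  by rewrite /coord uq => ->.
apply: cvg_near_cst; apply: filterS hu => x.
by rewrite /coord (negbTE uq) => ->.
Qed.

Lemma fan_hausdorff : hausdorff_space X.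
Proof. exact: metric_hausdorff. Qed.

(** An ultrafilter decides, for each word [u], whether the points are on legs that
    extend [u].  If the heights do not tend to [0], the words chosen have bounded
    size because lengths decrease geometrically; the longest of them is the leg
    of the limit. *)
Lemma fan_compact : compact [set: X].
Proof.
rewrite compact_ultra => F FU _ /=.
have [s0 [s01 s0F]] : `[0, 1] `&` cluster (ht @ F) !=set0.
  apply: (@segment_compact R 0 1).
  by apply: nearW => p /=; rewrite in_itv /= ht_ge0 ht_le1.
have hts : ht @ F --> s0.
  apply/cvgrPdist_lt => e e0.
  have [//|nF] := in_ultra_setVsetC [set p | `|s0 - ht p| < e] FU.
  have [] := s0F [set s | ~ `|s0 - s| < e] (ball s0 e) nF (nbhsx_ballx _ _ e0).
  by move=> s [].
have [s00|s0_gt0] : s0 = 0 \/ 0 < s0.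
  by move: s01; rewrite /= in_itv /= => /andP[]; rewrite le_eqVlt => /orP[/eqP->|]; [left|right].
  by exists top; split => //; apply: (@cvg_top _ F _ id); rewrite -s00.
pose P u := F [set p : X | prefix u (leg p)].
have Pnil : P [::] by apply: nearW => p /=; exact: prefix0s.
have near_s0 e : 0 < e -> \forall p \near F, `|s0 - ht p| < e.
  by move=> e0; have /cvgrPdist_lt/(_ e e0) := hts.
have [n Pn] : exists n, forall u, P u -> (size u < n)%N.
  have [|n hn] := @pow2_small (s0 / 2); first by rewrite divr_gt0.
  exists n => u Pu; rewrite ltnNge; apply/negP => nu.
  have s2 : 0 < s0 / 2 by rewrite divr_gt0.
  have [p []] := @filter_ex _ F _ _ (@filterI _ F _ _ _ Pu (near_s0 _ s2)).
  rewrite /= ltr_norml => /len_prefix uw /andP[_ h2].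
  have := le_trans (ht_le p) (uw R M); have := len_le_pow (R := R) M u.
  have := pow2_le (R := R) nu; lra.
have [w Pw nPw] : exists2 w, P w & forall a, ~ P (rcons w a).
  apply: contrapT => no; suff : forall n, exists2 u, size u = n & P u.
    by move=> /(_ n)[u us /Pn]; rewrite us ltnn.
  elim=> [|k [u uk Pu]]; first by exists [::].
  apply: contrapT => nu; apply: no; exists u => // a Pa; apply: nu.
  by exists (rcons u a); rewrite ?size_rcons ?uk.
have s0w : s0 <= len w.
  rewrite leNgt; apply/negP => ws0.
  have e0 : 0 < s0 - len w by rewrite subr_gt0.
  have [p []] := @filter_ex _ F _ _ (@filterI _ F _ _ _ Pw (near_s0 _ e0)).
  rewrite /= ltr_norml => /(@len_prefix R M) uw /andP[_ h2].
  have := ht_le p; lra.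
have [lq hq] := @ptE R M w s0 (introT andP (conj s0_gt0 s0w)).
exists (pt w s0); split => //; apply: (@cvg_leg _ F _ id); rewrite ?hq //.
move=> u; rewrite lq; have [uw|uw] := boolP (prefix u w).
  by apply: filterS Pw => p /=; exact: prefix_trans.
have [Pu|] := in_ultra_setVsetC [set p : X | prefix u (leg p)] FU; last first.
  by apply: filterS => p /negP/negbTE.
have [p [/= up wp]] := @filter_ex _ F _ _ (@filterI _ F _ _ _ Pu Pw).
have := prefix_linear up wp; rewrite (negbTE uw) /= => /prefixP[[|a v] uE].
  by rewrite uE cats0 prefix_refl in uw.
case: (nPw a); apply: filterS Pu => p' /= /(prefix_trans _); apply.
by rewrite uE -cat_rcons prefix_prefix.
Qed.
End Topology.
Arguments coord_continuous {R M} u x.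
Arguments ht_continuous {R M} x.

(** * Subcontinua are convex *)

Section Convexity.
Context {R : realType} {M : pred nat}.
Local Notation X := (fan R M).
Local Notation len := (@leg_len R M).
Implicit Types (p q z : X) (s : R).

Definition below p q := (p == top) || (leg p == leg q) && (ht p <= ht q).

(** Two points on different legs are joined through the top; [top] is [below]
    every point, so it belongs to the second case as well. *)
Definition seg p q : set X := [set z | if leg p == leg q
  then (leg z == leg p) && (Num.min (ht p) (ht q) <= ht z <= Num.max (ht p) (ht q))
  else below z p || below z q].

Lemma segC p q : seg p q = seg q p.
Proof.
apply/funext => z; rewrite /seg /= [leg q == _]eq_sym minC maxC orbC.
by case: eqP => // ->.
Qed.

(** This continuous function is the height on the legs that extend [w] and no word
    of [L], and is at most [0] on all the others.  It plays the part of the height on arbitrarily small neighborhoods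
    of the leg [w]. *)
Definition probe w (L : seq word) p : R := coord w p - \sum_(u <- L) coord u p.

Lemma probe_continuous w L : continuous (probe w L : X -> R).
Proof.
move=> p; apply: cvgB; first exact: coord_continuous.
elim: L => [|u L IH].
  under eq_fun do rewrite big_nil.
  rewrite big_nil; exact: cvg_cst.
under eq_fun do rewrite big_cons.
rewrite big_cons.
by apply: cvgD => //; exact: coord_continuous.
Qed.

Lemma probe_eq w L p : prefix w (leg p) -> (forall u, u \in L -> ~~ prefix u (leg p)) ->
  probe w L p = ht p.
Proof.
move=> wp h; rewrite /probe big_seq big1 => [|u /h]; rewrite /coord ?wp ?subr0//.
by move/negbTE->.
Qed.

Lemma probe_gt0 w L p : 0 < probe w L p ->
  prefix w (leg p) /\ (forall u, u \in L -> ~~ prefix u (leg p)).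
Proof.
have S0 (l : seq word) : 0 <= \sum_(u <- l) coord u p.
  by apply: sumr_ge0 => u _; exact: coord_ge0.
rewrite /probe subr_gt0 => h; have h' := le_lt_trans (S0 L) h.
move: (h'); rewrite coord_gt0 => /andP[wp p0]; split=> // u uL; apply/negP => up.
move: h; rewrite ltNge => /negP; apply; rewrite (big_rem u)//=.
by rewrite {1 2}/coord wp up lerDl.
Qed.

(** A point of the leg of [p] is not a cut point of the fan, since nearby legs pass
    by it.  But on the legs close to that of [p] a probe plays the part of the
    height, and by the intermediate value theorem a connected set contains a point
    of height [s] on one of them.  Closer and closer legs give points of [K] that
    converge to the given one. *)
Lemma cut K p q s : closed K -> connected K -> K p -> K q ->
  0 < s < ht p -> ~~ ((leg q == leg p) && (s < ht q)) -> K (pt (leg p) s).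
Proof.
set w := leg p => cK nK Kp Kq /andP[s0 sp] nq.
have sw : 0 < s <= len w by rewrite s0 (le_trans (ltW sp))// ht_le.
(* [leg q] is in the list to make the probe nonpositive at [q] even if [leg q]
   extends [w] *)
pose L n := leg q :: pmap unpickle (iota 0 n).
pose Lw n := [seq u <- L n | ~~ prefix u w].
have ex n : exists x, [/\ K x, prefix w (leg x), ht x = s &
    forall u, u \in Lw n -> ~~ prefix u (leg x)].
  have /connected_intervalP IK : connected (probe w (Lw n) @` K).
    apply: connected_continuous_connected nK _.
    exact/continuous_subspaceT/probe_continuous.
  have pp : probe w (Lw n) p = ht p.
    by apply: probe_eq => [|u]; rewrite ?prefix_refl// mem_filter => /andP[].
  have qs : probe w (Lw n) q <= s.
    rewrite leNgt; apply/negP => qs; move: nq.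
    have [wq nL] := probe_gt0 (lt_trans s0 qs).
    have -> : leg q = w.
      apply/eqP; rewrite eqE /=; apply/eqP; apply: prefix_anti => //.
      apply/negPn/negP => qw; have := nL (leg q).
      by rewrite mem_filter qw mem_head prefix_refl => /(_ isT).
    by rewrite eqxx /= -(probe_eq wq nL) qs.
  have [] := IK (probe w (Lw n) q) (probe w (Lw n) p) _ _ s.
  - by exists q.
  - by exists p.
  - by rewrite qs pp ltW.
  move=> x Kx xs; exists x; have [|wx xL] := @probe_gt0 w (Lw n) x.
    by rewrite xs.
  by split=> //; rewrite -(probe_eq wx xL).
have [x xP] := choice ex.
apply: (@closed_cvg _ _ \oo _ x K cK); first by apply: nearW => n; have [] := xP n.
have [lz hz] := ptE sw.
apply: cvg_leg => [|u]; rewrite ?lz ?hz.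
  by apply: cvg_near_cst; apply: nearW => n; have [] := xP n.
have [uw|uw] := boolP (prefix u w).
  by apply: nearW => n; have [_ wx _ _] := xP n; exact: prefix_trans wx.
exists (pickle u).+1 => // n /= un; have [_ _ _ /(_ u)] := xP n.
rewrite mem_filter uw inE mem_pmap => h; apply/negbTE/h/orP; right.
by apply/mapP; exists (pickle u); rewrite ?pickleK// mem_iota.
Qed.

Lemma clamp_continuous (l : R) :
  continuous (fun h : R => Num.max 0 (Num.min h l)).
Proof.
move=> h; apply: (@continuous_max R R^o (cst 0) (fun h => Num.min h l) h).
  exact: cst_continuous.
apply: (@continuous_min R R^o id (cst l) h); first exact: cvg_id.
exact: cst_continuous.
Qed.

Lemma pt_cvg0 w : pt w s @[s --> (0:R)^'+] --> (top : X).
Proof.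
apply: cvg_top; under eq_fun do rewrite ht_pt.
apply: cvg_at_right_filter; have := @clamp_continuous (len w) 0.
by rewrite /continuous_at min_l ?len_ge0// maxxx.
Qed.

Lemma convex K p q : closed K -> connected K -> K p -> K q -> seg p q `<=` K.
Proof.
move=> cK nK Kp Kq z; rewrite /seg /=; case: eqVneq => [pq|npq].
  wlog hpq : p q Kp Kq pq / ht p <= ht q.
    move=> wl; case/orP: (le_total (ht p) (ht q)) => [pq'|qp'].
      exact: wl.
    by rewrite minC maxC pq; apply: wl.
  rewrite min_l// max_r// => /andP[/eqP zp /andP[pz zq]].
  have [h|hz] := eqVneq (ht z) (ht q); first by rewrite (fan_eq _ h)// zp.
  have [h|hz'] := eqVneq (ht z) (ht p); first by rewrite (fan_eq _ h).
  rewrite -(pt_id z) zp pq; apply: (cut cK nK Kq Kp).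
    by rewrite (le_lt_trans (ht_ge0 p)) lt_neqAle ?hz ?zq// eq_sym hz'.
  by rewrite negb_and -leNgt pz orbT.
wlog : p q Kp Kq npq / below z p.
  move=> wl /orP[] zz; first by apply: (wl p q) => //; rewrite zz.
  by apply: (wl q p); rewrite 1?eq_sym ?zz.
move=> zp _.
have inK s : 0 < s <= ht p -> K (pt (leg p) s).
  move=> /andP[s0]; rewrite le_eqVlt => /orP[/eqP->|sp]; first by rewrite pt_id.
  by apply: (cut cK nK Kp Kq); rewrite ?s0// eq_sym (negbTE npq).
have [z0|z0] := eqVneq z top; last first.
  move: zp; rewrite /below (negbTE z0) /= => /andP[/eqP zp hz].
  by rewrite -(pt_id z) zp; apply: inK; rewrite ht_gt0 z0.
have [p0|p0] := eqVneq p top; first by rewrite z0 -p0.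
rewrite z0; apply: (@closed_cvg _ _ (0:R)^'+ _ (pt (leg p)) K cK).
  near=> s; apply: inK; apply/andP; split; near: s; first exact: nbhs_right_gt.
  by apply: nbhs_right_le; rewrite ht_gt0.
exact: pt_cvg0.
Unshelve. all: by end_near. Qed.
End Convexity.

(** * Arcs *)

Section Arcs.
Context {R : realType} {M : pred nat}.
Local Notation X := (fan R M).
Local Notation len := (@leg_len R M).
Implicit Types (p q z : X) (s h a b : R).

(** The line through two legs, the second one at negative heights.  Every segment is
    the image of an interval by such a map, also when it lies on one leg. *)
Definition spine w w' h : X := if 0 <= h then pt w h else pt w' (- h).

Lemma coord_spine u w w' h : coord u (spine w w' h) =
  (if prefix u w then Num.max 0 (Num.min h (len w)) else 0) +
  (if prefix u w' then Num.max 0 (Num.min (- h) (len w')) else 0).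
Proof.
rewrite /spine; have [h0|h0] := leP 0 h; rewrite coord_pt.
  by rewrite [X in _ + if _ then X else 0]max_l ?if_same ?addr0// ge_min oppr_le0 h0.
by rewrite [X in (if _ then X else 0) + _]max_l ?if_same ?add0r// ge_min (ltW h0).
Qed.

Lemma spine_continuous w w' : continuous (spine w w').
Proof.
move=> h; apply/cvg_coord => u; under eq_fun do rewrite coord_spine.
rewrite coord_spine; apply: cvgD.
  by case: (prefix u w); [exact: clamp_continuous|exact: cvg_cst].
case: (prefix u w'); last exact: cvg_cst.
apply: (@continuous_comp _ _ _ -%R (fun h => Num.max 0 (Num.min h (len w')))).
  exact: oppr_continuous.
exact: clamp_continuous.
Qed.

Lemma spine_pos w w' h : 0 < h <= len w ->
  leg (spine w w' h) = w /\ ht (spine w w' h) = h.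
Proof. by move=> /[dup] /andP[h0 _]; rewrite /spine (ltW h0) => /ptE. Qed.

Lemma spine_neg w w' h : - len w' <= h < 0 ->
  leg (spine w w' h) = w' /\ ht (spine w w' h) = - h.
Proof.
move=> /andP[hw h0]; rewrite /spine leNgt h0 /=; apply: ptE.
by rewrite oppr_gt0 h0 lerNl.
Qed.

Lemma spine0 w w' : spine w w' 0 = top.
Proof. by rewrite /spine lexx pt_top. Qed.

(** The inverse of [spine w w'].  One of the two words may be a prefix of the other,
    and then the coordinate of the shorter one does not tell the legs apart. *)
Definition signed_ht w w' p : R :=
  if prefix w' w then coord w p *+ 2 - ht p else ht p - coord w' p *+ 2.

Lemma signed_ht_continuous w w' : continuous (signed_ht w w').
Proof.
move=> p; rewrite /signed_ht; case: (prefix w' w); apply: cvgB.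
- by apply: cvgMn; exact: coord_continuous.
- exact: ht_continuous.
- exact: ht_continuous.
- by apply: cvgMn; exact: coord_continuous.
Qed.

Lemma spineK w w' h : w != w' -> - len w' <= h <= len w ->
  signed_ht w w' (spine w w' h) = h.
Proof.
move=> ww' /andP[hw' hw]; rewrite /signed_ht /coord.
case: (ltrgtP h 0) => [h0|h0|->]; last by rewrite spine0 ht_top !if_same mul0rn subrr if_same.
- have [-> ->] : leg (spine w w' h) = w' /\ ht (spine w w' h) = - h.
    by apply: spine_neg; rewrite hw'.
  rewrite prefix_refl; case: ifP => w'w; last by rewrite mulr2n; lra.
  by case: ifP => [/prefix_anti/(_ w'w)/eqP|_]; rewrite ?(negbTE ww')// mul0rn; lra.
have [-> ->] : leg (spine w w' h) = w /\ ht (spine w w' h) = h.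
  by apply: spine_pos; rewrite h0.
by rewrite prefix_refl; case: (prefix w' w); rewrite ?mulr2n ?mul0rn; lra.
Qed.

Lemma spine_arc w w' a b : w != w' -> - len w' <= a <= len w ->
  - len w' <= b <= len w -> a != b ->
  arc_between (spine w w' @` [set h | Num.min a b <= h <= Num.max a b])
    (spine w w' a) (spine w w' b).
Proof.
move=> ww' /andP[a1 a2] /andP[b1 b2] ab; have ba : b - a != 0 by rewrite subr_eq0 eq_sym.
pose f (r : R) := spine w w' (a + r * (b - a)).
pose g (p : X) := (signed_ht w w' p - a) / (b - a).
have bd (r : R) : 0 <= r <= 1 -> - len w' <= a + r * (b - a) <= len w.
  by move=> /andP[r0 r1]; apply/andP; split; nra.
exists f, g; split.
- apply/seteqP; split=> [_ [r /= + <-]|_ [h /= hab <-]].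
    rewrite in_itv /= => /andP[r0 r1]; exists (a + r * (b - a)) => //=.
    rewrite ge_min le_max; case/orP: (le_total a b) => ab'.
      by apply/andP; split; apply/orP; [left|right]; nra.
    by apply/andP; split; apply/orP; [right|left]; nra.
  exists ((h - a) / (b - a)); last by rewrite /f mulfVK// addrC subrK.
  rewrite /= in_itv /=; move: hab; have [lab|lab|e] := ltgtP a b.
  + by rewrite ler_pdivlMr ?ler_pdivrMr ?subr_gt0// mul0r mul1r; lra.
  + by rewrite ler_ndivlMr ?ler_ndivrMr ?subr_lt0// mul0r mul1r; lra.
  + by rewrite e eqxx in ab.
- apply: continuous_subspaceT => r.
  apply: (@continuous_comp _ _ _ (fun r : R => a + r * (b - a)) (spine w w')).
    apply: cvgD; first exact: cvg_cst.
    by apply: cvgM; [exact: cvg_id|exact: cvg_cst].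
  exact: spine_continuous.
- apply: continuous_subspaceT => p; apply: cvgM; last exact: cvg_cst.
  by apply: cvgB; [exact: signed_ht_continuous|exact: cvg_cst].
- move=> r; rewrite in_itv /= => r01; rewrite /g /f spineK ?bd//.
  by rewrite addrAC subrr add0r mulfK.
- by split; rewrite /f ?mul0r ?mul1r ?addr0// addrC subrK.
Qed.

Lemma seg_spine p q : exists w w' a b,
  [/\ w != w', - len w' <= a <= len w /\ - len w' <= b <= len w,
      spine w w' a = p, spine w w' b = q &
      seg p q = spine w w' @` [set h | Num.min a b <= h <= Num.max a b]].
Proof.
have [pq|npq] := eqVneq (leg p) (leg q).
  have wn : leg p != (0, 0)%N :: leg p.
    by apply/eqP => /(congr1 size) /= e; have := ltnn (size (leg p)); rewrite {2}e leqnn.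
  have ge0 s : 0 <= s -> - len ((0, 0)%N :: leg p) <= s.
    by apply: le_trans; rewrite oppr_le0 len_ge0.
  exists (leg p), ((0, 0)%N :: leg p), (ht p), (ht q); split => //.
  - by rewrite !ge0 ?ht_ge0 ?ht_le// pq ht_le.
  - by rewrite /spine ht_ge0 pt_id.
  - by rewrite /spine ht_ge0 pq pt_id.
  rewrite /seg pq eqxx; apply/seteqP; split=> [z /= /andP[/eqP zl zh]|_ [h /= hh <-]].
    by exists (ht z) => //; rewrite /spine ht_ge0 -zl pt_id.
  have h0 : 0 <= h.
    by apply: le_trans (proj1 (andP hh)); rewrite le_min !ht_ge0.
  rewrite /spine h0; move: h0; rewrite le_eqVlt => /orP[/eqP h0|h0]; last first.
    have [|-> ->] := @ptE R M (leg q) h; last by rewrite eqxx.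
    rewrite h0; apply: le_trans (proj2 (andP hh)) _.
    by rewrite ge_max -{1}pq !ht_le.
  move: hh; rewrite -h0 pt_top// ht_top leg_top => hh; rewrite hh andbT.
  move: hh => /andP[+ _]; rewrite ge_min => /orP[] p0; apply/eqP/esym.
    by rewrite -pq leg_ht0//; apply/eqP; rewrite eq_le p0 ht_ge0.
  by rewrite leg_ht0//; apply/eqP; rewrite eq_le p0 ht_ge0.
exists (leg p), (leg q), (ht p), (- ht q).
have q0 := ht_ge0 q; have p0 := ht_ge0 p; have pl := ht_le p; have ql := ht_le q.
have sq : spine (leg p) (leg q) (- ht q) = q.
  rewrite /spine; case: ifPn => [|_]; last by rewrite opprK pt_id.
  rewrite oppr_ge0 => q0'; have /eqP : ht q = 0 by apply/eqP; rewrite eq_le q0' q0.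
  by rewrite ht_eq0 => /eqP ->; rewrite ht_top oppr0 pt_top.
have sp : spine (leg p) (leg q) (ht p) = p by rewrite /spine p0 pt_id.
split => //.
  by rewrite lerN2 ql; split; apply/andP; split; lra.
have hm : - ht q <= ht p by lra.
rewrite /seg (negbTE npq) (min_r hm) (max_l hm).
apply/seteqP; split=> [z /= /orP[]|_ [h /= /andP[h1 h2] <-]].
- move=> /orP[/eqP->|/andP[/eqP zl zh]].
    by exists 0; rewrite ?spine0//=; apply/andP; split; lra.
  exists (ht z); last by rewrite /spine ht_ge0 -zl pt_id.
  by have := ht_ge0 z => /= ?; apply/andP; split; lra.
- move=> /orP[/eqP->|/andP[/eqP zl zh]].
    by exists 0; rewrite ?spine0//=; apply/andP; split; lra.
  exists (- ht z); first by have := ht_ge0 z => /= ?; apply/andP; split; lra.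
  rewrite /spine -zl opprK; case: ifPn => [|_]; last by rewrite pt_id.
  rewrite oppr_ge0 => z0; have /eqP : ht z = 0 by apply/eqP; rewrite eq_le z0 ht_ge0.
  by rewrite ht_eq0 => /eqP ->; rewrite ht_top oppr0 pt_top.
case: (ltrgtP h 0) => [h0|h0|->]; last by rewrite spine0 /below eqxx.
  have [|hl hh] := @spine_neg (leg p) (leg q) h; first by apply/andP; split; lra.
  by rewrite /below hl hh eqxx /= [_ <= ht q]lerNl h1 !orbT.
have [|hl hh] := @spine_pos (leg p) (leg q) h; first by apply/andP; split; lra.
by rewrite /below hl hh eqxx /= h2 orbT.
Qed.

Lemma seg_arc p q : p != q -> arc_between (seg p q) p q.
Proof.
have [w [w' [a [b [ww' [ha hb] <- <- ->]]]]] := seg_spine p q.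
move=> pq; apply: spine_arc => //; by apply: contraNneq pq => ->.
Qed.

Lemma seg_left p q : seg p q p.
Proof.
rewrite /seg /=; case: ifP => _; first by rewrite eqxx ge_min le_max lexx.
by rewrite /below eqxx lexx !orbT.
Qed.

Lemma seg_right p q : seg p q q.
Proof. by rewrite segC; exact: seg_left. Qed.

Lemma seg_continuum p q : is_continuum (seg p q).
Proof.
have [w [w' [a [b [_ _ _ _ E]]]]] := seg_spine p q.
have -> : seg p q = spine w w' @` `[Num.min a b, Num.max a b].
  by rewrite E; congr image; apply/seteqP; split=> h /=; rewrite in_itv.
have c : {within `[Num.min a b, Num.max a b], continuous (spine w w')}.
  exact/continuous_subspaceT/spine_continuous.
split.
- by apply/image_nonempty; exists a; rewrite /= in_itv /= ge_min le_max lexx.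
- by apply: continuous_compact => //; exact: segment_compact.
- by apply: connected_continuous_connected => //; exact: segment_connected.
Qed.

Lemma continuum_convex K p q : is_continuum K -> K p -> K q -> seg p q `<=` K.
Proof.
move=> [_ cK nK]; apply: convex => //.
by apply: compact_closed cK; exact: fan_hausdorff.
Qed.

Lemma arc_continuum (A : set X) p q : arc_between A p q -> is_continuum A.
Proof.
move=> [f [g [<- cf _ _ _]]]; split.
- by apply/image_nonempty; exists 0; rewrite /= in_itv /= lexx ler01.
- by apply: continuous_compact => //; exact: segment_compact.
- by apply: connected_continuous_connected => //; exact: segment_connected.
Qed.

Lemma arc_ends (A : set X) p q : arc_between A p q -> A p /\ A q.
Proof.
move=> [f [g [<- _ _ _ [<- <-]]]].
by split; [exists 0|exists 1]; rewrite //= in_itv /= lexx ler01.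
Qed.

Lemma arc_neq (A : set X) p q : arc_between A p q -> p != q.
Proof.
move=> [f [g [_ _ _ K [<- <-]]]]; apply/eqP => /(congr1 g).
by rewrite !K ?in_itv /= ?lexx ?ler01// => /eqP; rewrite eq_sym oner_eq0.
Qed.

(** An arc contains the segment by convexity; the parameters of the points of that
    segment form a connected set that contains [0] and [1], so no point of the
    arc is left out. *)
Lemma arc_seg (A : set X) p q : arc_between A p q -> A = seg p q.
Proof.
move=> arcA; have cA := arc_continuum arcA; have [Ap Aq] := arc_ends arcA.
have [f [g [fA _ cg K [f0 f1]]]] := arcA.
have SA := continuum_convex cA Ap Aq; apply/seteqP; split=> // x Ax.
have [_ _ nS] := seg_continuum p q.
have /connected_intervalP I : connected (g @` seg p q).
  by apply: connected_continuous_connected nS _; exact: continuous_subspaceW cg.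
have g0 : g p = 0 by rewrite -f0 K// in_itv /= lexx ler01.
have g1 : g q = 1 by rewrite -f1 K// in_itv /= lexx ler01.
move: (Ax); rewrite -fA => -[r r01 <-].
have [|||y Sy gy] := I (g p) (g q) _ _ r.
- by exists p => //; exact: seg_left.
- by exists q => //; exact: seg_right.
- by rewrite g0 g1; move: r01; rewrite /= in_itv.
have := SA _ Sy; rewrite -fA => -[r' r'01 fr'].
by move: Sy; rewrite -gy -{1 2}fr' K// fr'.
Qed.
End Arcs.

(** * A smooth fan *)

Section SmoothFan.
Context {R : realType} {M : pred nat}.
Local Notation X := (fan R M).
Local Notation len := (@leg_len R M).
Implicit Types (p q z s : X) (a b : X).

Lemma convex_connected (C : set X) :
  (forall p q, C p -> C q -> seg p q `<=` C) -> connected C.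
Proof.
move=> convC; have [->|/set0P[p Cp]] := eqVneq C set0; first exact: connected0.
have -> : C = \bigcup_(q in C) seg p q.
  apply/seteqP; split=> [q Cq|z [q Cq]]; last exact: convC.
  by exists q => //; exact: seg_right.
apply: bigcup_connected; first by exists p => q _; exact: seg_left.
by move=> q _; have [] := seg_continuum p q.
Qed.

Lemma fan_dendroid : dendroid X.
Proof.
split.
- split; [by exists top|exact: fan_compact|exact: convex_connected].
- by move=> p q /seg_arc; exists (seg p q).
- move=> K _ A B cA cB _; apply: convex_connected => p q [Ap Bp] [Aq Bq] z zpq.
  by split; [apply: continuum_convex cA Ap Aq _ zpq|apply: continuum_convex cB Bp Bq _ zpq].
Qed.

Definition tip w : X := pt w (len w).

Lemma tipE w : admissible M w -> leg (tip w) = w /\ ht (tip w) = len w.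
Proof. by move=> wM; apply: ptE; rewrite lexx len_gt0 wM. Qed.

Lemma below_topE z : below z top = (z == top).
Proof.
rewrite /below; apply/orb_idr => /andP[_]; rewrite ht_top => z0.
by rewrite -ht_eq0 eq_le z0 ht_ge0.
Qed.

Lemma below_top p : below top p. Proof. by rewrite /below eqxx. Qed.

Lemma below_ht z p : below z p -> ht z <= ht p.
Proof. by case/orP => [/eqP->|/andP[]//]; rewrite ht_top ht_ge0. Qed.

Lemma below_leg z p : below z p -> z != top -> leg z = leg p.
Proof. by case/orP => [->//|/andP[/eqP]]. Qed.

Lemma below_pt p (h : R) : 0 <= h <= ht p -> below (pt (leg p) h) p.
Proof.
move=> /andP[h0 hp]; move: h0; rewrite le_eqVlt => /orP[/eqP<-|h0].
  by rewrite pt_top// below_top.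
have [|lh hh] := @ptE R M (leg p) h; first by rewrite h0 (le_trans hp)// ht_le.
by rewrite /below lh hh hp eqxx orbT.
Qed.

Lemma seg_topE p : seg top p = [set z | below z p].
Proof.
apply/funext => z; apply/propext; rewrite /seg /= leg_top ht_top below_topE eq_sym.
rewrite min_l ?max_r ?ht_ge0//=.
case: eqVneq => [lp|_]; last first.
  by split=> [/orP[/eqP->|//]|->]; rewrite ?below_top ?orbT.
rewrite /below lp; split=> [->|/orP[/eqP->|//]]; first by rewrite orbT.
by rewrite leg_top ht_top ht_ge0 eqxx.
Qed.

Lemma the_arc_top p : the_arc top p = [set z | below z p].
Proof.
rewrite /the_arc -seg_topE; case: eqVneq => [<-|p0].
  apply/seteqP; rewrite seg_topE; split=> z /=; first by move->; rewrite below_top.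
  by rewrite below_topE => /eqP.
by apply: xget_unique => [|A /arc_seg//]; exact: seg_arc.
Qed.

(** ** The only ramification point *)

Definition above s a := (leg a == leg s) && (ht s < ht a).

Lemma ht_pt_id w (h : R) : 0 <= h <= len w -> ht (pt w h : X) = h.
Proof. by move=> /andP[h0 hw]; rewrite ht_pt min_l// max_r. Qed.

(** Convexity leaves only two ways to leave a point [s] of a leg: up or down the
    leg.  In both cases a whole interval of the leg is covered. *)
Lemma triod_branch s a : s != top -> a != s ->
  exists2 r : R, 0 <= r <= len (leg s) &
  if above s a then ht s < r /\ forall h, ht s <= h <= r -> seg s a (pt (leg s) h)
  else r < ht s /\ forall h, r <= h <= ht s -> seg s a (pt (leg s) h).
Proof.
move=> s0 as_; have hs0 := s0; rewrite -ht_gt0 in hs0; have hs := ht_le s.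
case: (boolP (above s a)) => [/andP[/eqP la ha]|].
  exists (ht a); rewrite ?ht_ge0//= -?la ?ht_le//; split => // h /andP[h1 h2].
  have [|lh hh] := @ptE R M (leg s) h.
    by rewrite (lt_le_trans hs0 h1) (le_trans h2)// -la ht_le.
  by rewrite /seg /= la lh hh !eqxx min_l ?max_r ?h1 ?h2// ltW.
rewrite /above negb_and -leNgt; case: (eqVneq (leg a) (leg s)) => [la /= ha|la _].
  have ha' : ht a < ht s.
    by rewrite lt_neqAle ha andbT; apply: contraNneq as_ => /(fan_eq la) ->.
  have a0 : 0 <= ht a := ht_ge0 a.
  exists ((ht a + ht s) / 2); first by apply/andP; split; lra.
  split; first by lra.
  move=> h /andP[h1 h2].
  have [|lh hh] := @ptE R M (leg s) h; first by apply/andP; split; lra.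
  by rewrite /seg /= la lh hh !eqxx min_r ?max_l// h2 andbT; lra.
exists 0; first by rewrite lexx len_ge0.
split => // h hh; rewrite /seg /= eq_sym (negbTE la).
by rewrite below_pt.
Qed.

Lemma same_side_meet s a b : s != top -> a != s -> b != s ->
  above s a = above s b -> exists2 z, z != s & (seg s a `&` seg s b) z.
Proof.
move=> s0 as_ bs ab.
have [r r0] := triod_branch s0 as_; have [r' r0'] := triod_branch s0 bs.
have neq h : 0 <= h <= len (leg s) -> h != ht s -> pt (leg s) h != s.
  by move=> h01; apply: contraNneq => /(congr1 ht); rewrite ht_pt_id// => ->.
move: r0 r0' => /andP[r0 r1] /andP[r0' r1'].
rewrite -ab; case: ifP => _ [h1 H1] [h2 H2].
  exists (pt (leg s) (Num.min r r')).
    apply: neq; last by rewrite gt_eqF// lt_min h1 h2.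
    by rewrite le_min r0 r0' ge_min r1.
  split; [apply: H2|apply: H1].
    by rewrite le_min (ltW h1) (ltW h2) /= ge_min lexx.
  by rewrite le_min (ltW h1) (ltW h2) /= ge_min lexx orbT.
exists (pt (leg s) (Num.max r r')).
  apply: neq; last by rewrite lt_eqF// gt_max h1 h2.
  by rewrite le_max r0 ge_max r1 r1'.
split; [apply: H2|apply: H1].
  by rewrite le_max lexx /= ge_max (ltW h1) (ltW h2).
by rewrite le_max lexx orbT /= ge_max (ltW h1) (ltW h2).
Qed.

Lemma triod_top_unique s : simple_triod_top s -> s = top.
Proof.
move=> [A [B [C [a [b [c [[hA hB hC] AB AC BC]]]]]]]; apply/eqP/negPn/negP => s0.
have [na nb nc] : [/\ a != s, b != s & c != s].
  by split; rewrite eq_sym; [exact: arc_neq hA|exact: arc_neq hB|exact: arc_neq hC].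
move: AB AC BC; rewrite (arc_seg hA) (arc_seg hB) (arc_seg hC) => AB AC BC.
have no x y : x != s -> y != s -> seg s x `&` seg s y = [set s] -> above s x != above s y.
  move=> xs ys E; apply/eqP => xy; have [z zs] := same_side_meet s0 xs ys xy.
  by rewrite E /= => zE; rewrite zE eqxx in zs.
move: (no _ _ na nb AB) (no _ _ na nc AC) (no _ _ nb nc BC).
by case: (above s a); case: (above s b); case: (above s c).
Qed.

Lemma below_tips_top u v z : admissible M u -> admissible M v -> u != v ->
  below z (tip u) -> below z (tip v) -> z = top.
Proof.
move=> uM vM uv zu zv; apply/eqP/negPn/negP => z0; move: uv.
have [lu _] := tipE uM; have [lv _] := tipE vM.
by rewrite -lu -lv -(below_leg zu z0) -(below_leg zv z0) eqxx.
Qed.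

Lemma tip_neq_top w : admissible M w -> tip w != top.
Proof. by move=> wM; have [_ h] := tipE wM; rewrite -ht_gt0 h len_gt0. Qed.

Lemma triod_top_top : simple_triod_top (top : X).
Proof.
pose u : word := [::]; pose v : word := [:: (0, 0)%N]; pose w : word := [:: (0, 1)%N].
have arc x : admissible M x -> arc_between (seg top (tip x)) top (tip x).
  by move=> xM; apply: seg_arc; rewrite eq_sym tip_neq_top.
have meet x y : admissible M x -> admissible M y -> x != y ->
    seg top (tip x) `&` seg top (tip y) = [set top].
  move=> xM yM xy; rewrite !seg_topE; apply/seteqP; split=> z /=.
    by case; exact: below_tips_top xy.
  by move=> ->; rewrite !below_top.
exists (seg top (tip u)), (seg top (tip v)), (seg top (tip w)), (tip u), (tip v), (tip w).
by split; [split; apply: arc|apply: meet|apply: meet|apply: meet].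
Qed.

Lemma fan_has_top : fan_with_top (top : X).
Proof.
split; first exact: fan_dendroid.
apply/seteqP; split=> s /=; first exact: triod_top_unique.
by move->; exact: triod_top_top.
Qed.

(** ** Smoothness *)

Definition scale (r : R) p : X := pt (leg p) (r * ht p).

Lemma scale_le r p : 0 <= r <= 1 -> 0 <= r * ht p <= ht p.
Proof. by move=> /andP[r0 r1]; rewrite mulr_ge0 ?ht_ge0//= ler_piMl// ht_ge0. Qed.

Lemma below_scale r p : 0 <= r <= 1 -> below (scale r p) p.
Proof. by move=> /(scale_le p); exact: below_pt. Qed.

Lemma scale_below z p : below z p -> exists2 r : R, 0 <= r <= 1 & z = scale r p.
Proof.
move=> zp; have [z0|z0] := eqVneq z top.
  by exists 0; rewrite ?lexx ?ler01// /scale mul0r pt_top.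
have hz := below_ht zp; rewrite -ht_gt0 in z0.
have hp := lt_le_trans z0 hz.
exists (ht z / ht p); first by rewrite divr_ge0 ?ht_ge0//= ler_pdivrMr// mul1r.
rewrite /scale divfK ?gt_eqF// -{1}(pt_id z) (below_leg zp)// -ht_gt0//.
Qed.

Lemma coord_scale u r p : 0 <= r <= 1 -> coord u (scale r p) = r * coord u p.
Proof.
move=> r01; have /andP[h0 h1] := scale_le p r01.
by rewrite /scale coord_pt min_l ?(le_trans h1) ?ht_le// max_r// /coord; case: ifP; rewrite ?mulr0.
Qed.

Lemma fdist_scale r p q : 0 <= r <= 1 -> fdist (scale r p) (scale r q) <= fdist p q.
Proof.
move=> /[dup] r01 /andP[r0 r1]; apply: fdist_le => u.
apply: le_trans (wdist_le p q u); rewrite /wdist ler_pM2r ?invr_gt0//.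
by rewrite !coord_scale// -mulrBr normrM ger0_norm// ler_piMl.
Qed.

Lemma edist_inf_below z p q : below z p ->
  (edist_inf [set y | below y q] z <= (fdist p q)%:E)%E.
Proof.
move=> /scale_below[r r01 ->]; apply: (@le_trans _ _ (edist (scale r p, scale r q))).
  by apply: ereal_inf_lbound; exists (scale r q) => //; exact: below_scale.
apply/lee_addgt0Pr => e e0; rewrite -EFinD.
apply: edist_fin; first by rewrite ltr_wpDl// fdist_ge0.
by rewrite ballEmdist /= (le_lt_trans (fdist_scale p q r01))// ltrDl.
Qed.

Lemma hausdorff_below p q :
  (0 <= hausdorff_dist (the_arc top p) (the_arc top q) <= (fdist p q)%:E)%E.
Proof.
rewrite !the_arc_top /hausdorff_dist; apply/andP; split.
  rewrite le_max; apply/orP; left.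
  apply: le_trans (@edist_inf_ge0 _ _ [set z | below z q] top) _.
  by apply: ereal_sup_ubound; exists top => //=; exact: below_top.
rewrite ge_max; apply/andP; split; apply: ge_ereal_sup => _ [z zp <-].
  exact: edist_inf_below.
by rewrite fdist_sym; exact: edist_inf_below.
Qed.

Lemma fan_smooth : smooth_at (top : X).
Proof.
move=> x p xp; apply: (@squeeze_cvge _ _ _ _ (cst 0%E) _ (fun n => (fdist (x n) p)%:E)).
- by apply: nearW => n; exact: hausdorff_below.
- exact: cvg_cst.
apply: cvg_EFin; first by apply: nearW.
apply/cvgrPdist_lt => e e0.
have xpe := @metricType_numDomainType.cvgr_dist_lt _ _ _ _ _ x p xp _ e0.
near=> n; rewrite /= sub0r normrN ger0_norm ?fdist_ge0// fdist_sym.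
by near: n; exact: xpe.
Unshelve. all: by end_near. Qed.

Lemma fan_smooth_fan : smooth_fan X.
Proof. by exists top; split; [exact: fan_has_top|exact: fan_smooth]. Qed.
End SmoothFan.

(** * Homogeneity *)

(** If [v] starts as [w] does up to the last letter of [w], and goes on with a
    letter [(m, n)] with the same [m], this applies [f] to [n]; other words are
    unchanged.  With [bump], the siblings of [w] from [w] on move one place up, so
    that no word extends [w] any more; with [unbump] they move back. *)
Fixpoint relabel (f : nat -> nat -> nat) w v : word :=
  match w, v with
  | a :: w', b :: v' =>
      if w' == [::] then (if a.1 == b.1 then (b.1, f a.2 b.2) :: v' else v)
      else if a == b then b :: relabel f w' v' else v
  | _, _ => v
  end.

Lemma relabel_nil f w : relabel f w [::] = [::].
Proof. by case: w. Qed.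

Lemma relabel_fst f w v : [seq a.1 | a <- relabel f w v] = [seq a.1 | a <- v].
Proof.
elim: w v => [|a w IH] [|b v] //=.
by case: ifP => _; case: ifP => //= _; rewrite IH.
Qed.

Lemma prefix_relabel_bump w v : w != [::] -> ~~ prefix w (relabel bump w v).
Proof.
elim: w v => [|a w IH] [|b v] //= _; case: eqVneq => [->|wn].
  case: ifPn => [/eqP ab|ab] /=; rewrite prefix0s andbT; last by apply: contraNneq ab => ->.
  by rewrite [a]surjective_pairing xpair_eqE (negbTE (neq_bump _ _)) andbF.
case: ifPn => [/eqP<-|ab] /=; last by rewrite (negbTE ab).
by rewrite negb_and IH ?orbT.
Qed.

Lemma relabel_bumpK w v : relabel unbump w (relabel bump w v) = v.
Proof.
elim: w v => [|a w IH] [|b v] //=; case: eqVneq => [_|_].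
  by case: ifPn => [ab|/negbTE->//] /=; rewrite ab bumpK -surjective_pairing.
by case: ifPn => [/eqP->|/negbTE -> //]; rewrite eqxx IH.
Qed.

Lemma relabel_unbumpK w v : ~~ prefix w v -> relabel bump w (relabel unbump w v) = v.
Proof.
elim: w v => [|a w IH] [|b v] //=; case: (eqVneq w [::]) => [->|_].
  rewrite prefix0s andbT; case: ifPn => [/eqP ab|/negbTE->//] /= nab.
  rewrite ab eqxx unbumpK -?surjective_pairing// inE.
  apply: contraNneq nab => e.
  by rewrite [a]surjective_pairing [b]surjective_pairing ab e.
by case: ifPn => [/eqP->|/negbTE -> //]; rewrite eqxx /= => nwv; rewrite IH.
Qed.

Lemma prefix_relabel w u v :
  prefix (relabel bump w u) (relabel bump w v) = prefix u v.
Proof.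
elim: w u v => [|a w IH] [|b u] [|c v] //=; rewrite ?prefix0s//.
  by case: ifP => _; case: ifP.
case: eqVneq => [_|wn].
  case: ifPn => ab; case: ifPn => ac //=;
    rewrite [b]surjective_pairing [c]surjective_pairing !xpair_eqE //=.
  - by rewrite -(eqP ab) -(eqP ac) (inj_eq (can_inj (bumpK _))).
  - by rewrite -(eqP ab) (negbTE ac).
  - by rewrite -(eqP ac) [_ == a.1]eq_sym (negbTE ab).
case: ifPn => [/eqP<-|ab]; case: ifPn => [/eqP<-|ac] //=; rewrite ?eqxx ?IH//.
  by rewrite (negbTE ac).
by rewrite [b == a]eq_sym (negbTE ab).
Qed.

Section Swap.
Context (w : word) (w0 : w != [::]).

(** Both the words that extend [w] and those that do not form a copy of the tree of
    all words, by removal of the prefix and by [relabel unbump w] respectively;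
    [swap] exchanges the two copies. *)
Definition swap v := if prefix w v then relabel bump w (drop (size w) v)
  else w ++ relabel unbump w v.

Lemma prefix_swap_root v : prefix w (swap v) = ~~ prefix w v.
Proof.
rewrite /swap; case: ifP => _; last by rewrite prefix_prefix.
by rewrite (negbTE (prefix_relabel_bump _ w0)).
Qed.

Lemma swapK : involutive swap.
Proof.
move=> v; rewrite /swap; case: (boolP (prefix w v)) => wv.
  rewrite (negbTE (prefix_relabel_bump _ w0)) relabel_bumpK.
  by move: wv => /prefixP[v' ->]; rewrite drop_size_cat.
by rewrite prefix_prefix drop_size_cat// relabel_unbumpK.
Qed.

(** The clopen set of words that extend [u] is pulled back by [swap] to one given by
    two prefix tests: this is the continuity of [swap]. *)
Lemma prefix_swap u v : prefix u (swap v) =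
  if prefix w v then ~~ prefix w u && prefix (w ++ relabel unbump w u) v
  else prefix u w || prefix w u && prefix (relabel bump w (drop (size w) u)) v.
Proof.
rewrite /swap; case: ifPn => [/prefixP[v' ->]|nwv].
  rewrite drop_size_cat//; case: (boolP (prefix w u)) => [wu|nwu] /=.
    apply/negP => uv; move: (prefix_relabel_bump v' w0).
    by rewrite (prefix_trans wu uv).
  by rewrite -{1}(relabel_unbumpK nwu) prefix_relabel prefix_catr// eqxx.
have [/prefixP[u' ->]|nwu] /= := boolP (prefix w u).
  rewrite drop_size_cat// prefix_catr// eqxx -{2}(relabel_unbumpK nwv) prefix_relabel.
  have [uw|//] := boolP (prefix (w ++ u') w); move: (size_prefix uw).
  rewrite size_cat -{2}[size w]addn0 leq_add2l leqn0 size_eq0 => /eqP ->.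
  by rewrite prefix0s.
rewrite orbF; apply/idP/idP => [uv|uw]; last exact: prefix_catl.
have := prefix_linear uv (prefix_prefix w _).
by rewrite (negbTE nwu) orbF.
Qed.
End Swap.

Section Homogeneity.
Context {R : realType} {M : pred nat}.
Local Notation X := (fan R M).
Local Notation len := (@leg_len R M).
Implicit Types (p q : X).

Lemma admissible_cat u v : admissible M (u ++ v) = admissible M u && admissible M v.
Proof. exact: all_cat. Qed.

Lemma len_fst u v : [seq a.1 | a <- u] = [seq a.1 | a <- v] -> len u = len v.
Proof.
move=> uv.
have aE x : admissible M x = all (allowed M) [seq a.1 | a <- x].
  by rewrite all_map.
have cE x : cost x = sumn [seq m.+1 | m <- [seq a.1 | a <- x]].
  by rewrite -map_comp.
have lE x : (last (0, 0)%N x).1 = last 0%N [seq a.1 | a <- x].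
  exact: (esym (last_map fst x (0, 0)%N)).
by rewrite /leg_len /depth !aE !cE !lE uv.
Qed.

Section Rescale.
Context (w : word) (wM : admissible M w).
Let c : R := 2^-1 ^+ cost w.

(** The piecewise linear map from the heights of the root leg to those of the leg
    [w], of slope [2^-(cost w)] up to the highest cluster point [1/2] and sending
    [1] to the end of the leg.  The legs other than the root only meet the first
    piece. *)
Definition shrink (s : R) : R :=
  2^-1 ^+ cost w * s + (len w - 2^-1 ^+ cost w) *+ 2 * Num.max 0 (s - 2^-1).

Definition expand (s : R) : R :=
  Num.min s (2^-1 ^+ cost w / 2) / 2^-1 ^+ cost w +
  Num.max 0 (s - 2^-1 ^+ cost w / 2) / (len w *+ 2 - 2^-1 ^+ cost w).

Lemma scale_gt0 : 0 < c. Proof. exact: exprn_gt0. Qed.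

Lemma scale_le_len : c <= len w.
Proof. by rewrite /leg_len wM pow2_le// depth_le_cost. Qed.

Lemma shrink_low s : s <= 2^-1 -> shrink s = c * s.
Proof. by move=> h; rewrite /shrink max_l ?subr_le0// mulr0 addr0. Qed.

Lemma shrink_high s : 2^-1 <= s -> shrink s = c / 2 + (len w *+ 2 - c) * (s - 2^-1).
Proof. by move=> h; rewrite /shrink max_r ?subr_ge0// -/c; ring. Qed.

Lemma expand_low s : s <= c / 2 -> expand s = s / c.
Proof. by move=> h; rewrite /expand min_l// max_l ?subr_le0// mul0r addr0. Qed.

Lemma expand_high s : c / 2 <= s -> expand s = 2^-1 + (s - c / 2) / (len w *+ 2 - c).
Proof.
move=> h; rewrite /expand min_r// max_r ?subr_ge0// -/c; congr (_ + _).
by rewrite mulrAC mulfV ?mul1r// gt_eqF// scale_gt0.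
Qed.

Lemma slope_gt0 : 0 < len w *+ 2 - c.
Proof. by have := scale_gt0; have := scale_le_len; lra. Qed.

Lemma shrinkK : cancel shrink expand.
Proof.
move=> s; have c0 := scale_gt0; have l0 := slope_gt0.
have [h|h] := leP s 2^-1.
  rewrite shrink_low// expand_low ?ler_pM2l// mulrAC mulfV ?mul1r//.
  by rewrite gt_eqF.
rewrite shrink_high ?(ltW h)// expand_high; last first.
  by rewrite lerDl mulr_ge0 ?(ltW l0)// subr_ge0 ltW.
by rewrite addrAC subrr add0r mulrAC mulfV ?gt_eqF// mul1r addrC subrK.
Qed.

Lemma expandK : cancel expand shrink.
Proof.
move=> s; have c0 := scale_gt0; have l0 := slope_gt0.
have [h|h] := leP s (c / 2).
  rewrite expand_low// shrink_low ?ler_pdivrMr// 1?mulrC// divfK//.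
  by rewrite gt_eqF.
rewrite expand_high ?(ltW h)// shrink_high; last first.
  by rewrite lerDl divr_ge0 ?(ltW l0)// subr_ge0 ltW.
by rewrite [2^-1 + _]addrC addrK [_ * (_ / _)]mulrC divfK ?gt_eqF// addrC subrK.
Qed.

Lemma shrink_mono : {mono shrink : s t / s <= t}.
Proof.
apply: le_mono => s t st; have c0 := scale_gt0; have l0 := scale_le_len.
rewrite /shrink -/c ltr_leD//; first by rewrite ltr_pM2l.
rewrite ler_wpM2l ?mulrn_wge0 ?subr_ge0//.
by rewrite ge_max le_max lexx /= le_max lerD2r (ltW st) orbT.
Qed.

Lemma expand_mono : {mono expand : s t / s <= t}.
Proof. by move=> s t; rewrite -shrink_mono !expandK. Qed.

Lemma shrink0 : shrink 0 = 0.
Proof. by rewrite shrink_low ?mulr0// invr_ge0. Qed.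

Lemma expand0 : expand 0 = 0.
Proof. by rewrite -{1}shrink0 shrinkK. Qed.

Lemma shrink_continuous : continuous shrink.
Proof.
move=> s; apply: cvgD; apply: cvgM; [exact: cvg_cst|exact: cvg_id|exact: cvg_cst|].
apply: (@continuous_max R R^o (cst 0) (fun s => s - 2^-1) s); first exact: cvg_cst.
by apply: cvgB; [exact: cvg_id|exact: cvg_cst].
Qed.

Lemma expand_continuous : continuous expand.
Proof.
move=> s; apply: cvgD; apply: cvgM; [|exact: cvg_cst| |exact: cvg_cst].
  by apply: (@continuous_min R R^o id (cst _) s); [exact: cvg_id|exact: cvg_cst].
apply: (@continuous_max R R^o (cst 0) (fun s => s - _) s); first exact: cvg_cst.
by apply: cvgB; [exact: cvg_id|exact: cvg_cst].
Qed.

Lemma len_nil : len [::] = 1.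
Proof. by rewrite /leg_len. Qed.

Lemma shrink_len v : shrink (len v) = len (w ++ v).
Proof.
have [->|v0] := eqVneq v [::].
  rewrite cats0 len_nil shrink_high; last by rewrite invf_le1// ler1n.
  by field.
have vh : len v <= 2^-1.
  case/lastP: v v0 => // v a _; rewrite /leg_len depth_rcons; case: ifP => _.
    by rewrite -[leRHS]expr1 pow2_le.
  by rewrite invr_ge0.
rewrite shrink_low// /leg_len admissible_cat wM /= depth_cat//.
by case: ifP; rewrite ?mulr0// exprD.
Qed.

End Rescale.

Section SwapFan.
Context (w : word) (wM : admissible M w) (w0 : w != [::]).

Definition swap_ht v : R -> R := if prefix w v then expand w else shrink w.

Definition swap_fan p : X := pt (swap w (leg p)) (swap_ht (leg p) (ht p)).

Lemma swap_ht0 v : swap_ht v 0 = 0.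
Proof. by rewrite /swap_ht; case: ifP => _; rewrite ?expand0 ?shrink0. Qed.

Lemma swap_ht_mono v : {mono swap_ht v : s t / s <= t}.
Proof. by rewrite /swap_ht; case: ifP => _; [exact: expand_mono|exact: shrink_mono]. Qed.

Lemma swap_htK v : cancel (swap_ht v) (swap_ht (swap w v)).
Proof.
rewrite /swap_ht prefix_swap_root//; case: (prefix w v) => /=.
  exact: expandK.
exact: shrinkK.
Qed.

Lemma swap_ht_len v : swap_ht v (len v) = len (swap w v).
Proof.
wlog nwv : v / ~~ prefix w v.
  move=> wl; case: (boolP (prefix w v)) => wv; last exact: wl.
  have := wl (swap w v); rewrite prefix_swap_root// wv swapK// => /(_ isT) <-.
  by have := swap_htK (swap w v) (len (swap w v)); rewrite swapK.
rewrite /swap_ht /swap (negbTE nwv).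
by rewrite -(len_fst (relabel_fst unbump w v)) shrink_len.
Qed.

Lemma swap_fan_top : swap_fan top = top.
Proof. by rewrite /swap_fan ht_top swap_ht0 pt_top. Qed.

Lemma swap_fanE p : p != top ->
  leg (swap_fan p) = swap w (leg p) /\ ht (swap_fan p) = swap_ht (leg p) (ht p).
Proof.
rewrite -ht_gt0 => p0; apply: ptE; rewrite -swap_ht_len swap_ht_mono ht_le andbT.
by rewrite -[ltLHS](swap_ht0 (leg p)) (leW_mono (swap_ht_mono _)).
Qed.

Lemma swap_fanK : involutive swap_fan.
Proof.
move=> p; have [->|p0] := eqVneq p top; first by rewrite !swap_fan_top.
have [lp hp] := swap_fanE p0.
by rewrite {1}/swap_fan lp hp swap_htK swapK// pt_id.
Qed.

(** One of the two terms is [0], according to whether the leg extends [w]; the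
    right-hand side is visibly continuous. *)
Lemma ht_swap_fan p : ht (swap_fan p) = shrink w (ht p - coord w p) + expand w (coord w p).
Proof.
have [->|p0] := eqVneq p top.
  by rewrite swap_fan_top /coord ht_top if_same subrr shrink0 expand0// addr0.
have [_ ->] := swap_fanE p0; rewrite /swap_ht /coord; case: ifP => _.
  by rewrite subrr shrink0 add0r.
by rewrite subr0 expand0// addr0.
Qed.

Lemma swap_fan_continuous : continuous swap_fan.
Proof.
have cht : continuous (ht \o swap_fan).
  have -> : ht \o swap_fan = fun p => shrink w (ht p - coord w p) + expand w (coord w p).
    by apply/funext => p; exact: ht_swap_fan.
  move=> p; apply: cvgD.
    apply: (@continuous_comp _ _ _ (fun p => ht p - coord w p) (shrink w)).
      by apply: cvgB; [exact: ht_continuous|exact: coord_continuous].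
    exact: shrink_continuous.
  apply: (@continuous_comp _ _ _ (coord w) (expand w)); first exact: coord_continuous.
  exact: expand_continuous.
move=> p; have [->|p0] := eqVneq p top.
  rewrite /continuous_at swap_fan_top; apply: cvg_top; have := cht top.
  by rewrite /continuous_at /= swap_fan_top ht_top.
apply: cvg_leg => [|u]; first exact: cht.
have [-> _] := swap_fanE p0.
near=> q; have q0 : q != top.
  rewrite -ht_gt0; near: q; apply: (cvgr_gt (ht p)).
    exact: ht_continuous.
  by rewrite ht_gt0.
have [-> _] := swap_fanE q0; rewrite !prefix_swap//.
congr (if _ then _ && _ else _ || _ && _); near: q; exact: near_leg.
Unshelve. all: by end_near. Qed.

Lemma swap_fan_tip : swap_fan (tip [::]) = tip w.
Proof.
have [l h] := @tipE R M [::] isT.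
rewrite /swap_fan l h swap_ht_len /tip.
suff -> : swap w [::] = w by [].
rewrite /swap prefixs0 (negbTE w0) relabel_nil cats0//.
Qed.
End SwapFan.

Lemma endpoint_tip (e : X) : is_endpoint e -> exists2 w, admissible M w & e = tip w.
Proof.
move=> he; have [e0|e0] := eqVneq e top.
  pose u : word := [::]; pose v : word := [:: (0, 0)%N].
  have uM : admissible M u by []. have vM : admissible M v by [].
  have uv : tip u != tip v :> X.
    by apply/eqP => /(congr1 leg); rewrite (tipE uM).1 (tipE vM).1.
  have [||] := he _ _ _ (seg_arc uv).
  - by rewrite e0 /seg /= (tipE uM).1 (tipE vM).1 /= below_top.
  - by move=> eu; have := @tip_neq_top R _ _ uM; rewrite -eu e0 eqxx.
  - by move=> ev; have := @tip_neq_top R _ _ vM; rewrite -ev e0 eqxx.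
have lM : admissible M (leg e).
  by rewrite -(@len_gt0 R); apply: lt_le_trans (ht_le e); rewrite ht_gt0.
exists (leg e) => //; have [lt' ht'] := @tipE R _ _ lM.
have tn : top != tip (leg e) :> X by rewrite eq_sym tip_neq_top.
have [||//] := he _ _ _ (seg_arc tn); last by move=> e0'; rewrite e0' eqxx in e0.
by rewrite seg_topE /= /below lt' ht' eqxx ht_le orbT.
Qed.

Lemma fan_endpoint_homogeneous : endpoint_homogeneous X.
Proof.
have to_tip w : admissible M w -> exists h g : X -> X,
    [/\ cancel h g, cancel g h, continuous h & continuous g] /\ h (tip [::]) = tip w.
  move=> wM; have [->|w0] := eqVneq w [::].
    by exists id, id; split=> //; split=> // x; exact: cvg_id.
  exists (swap_fan w), (swap_fan w); split; last exact: swap_fan_tip.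
  by split; [exact: swap_fanK|exact: swap_fanK| |]; exact: swap_fan_continuous.
move=> e e' /endpoint_tip[w wM ->] /endpoint_tip[w' wM' ->].
have [h [g [[hg gh ch cg] hw]]] := to_tip _ wM.
have [h' [g' [[hg' gh' ch' cg'] hw']]] := to_tip _ wM'.
exists (h' \o g); split; last by rewrite /= -hw hg.
exists (h \o g'); split.
- by move=> x /=; rewrite hg' gh.
- by move=> x /=; rewrite hg gh'.
- by move=> x; apply: continuous_comp; [exact: cg|exact: ch'].
- by move=> x; apply: continuous_comp; [exact: cg'|exact: ch].
Qed.

End Homogeneity.

(** * Telling the fans apart *)

Section OrderInvariants.
Context {R : realType} {M : pred nat}.
Local Notation X := (fan R M).
Implicit Types (e p q y z : X).

(** This and the next definitions only use the order [below] and the topology, so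
    they are invariant under homeomorphisms. *)
Definition is_tip e := e != top /\ forall p, below e p -> p = e.

Definition cluster_below e z :=
  [/\ z != top, limit_point (is_tip : set X) z & below z e].

(** Cluster points are numbered from the tip down, the highest one being the
    [0]th. *)
Fixpoint nth_cluster e k z : Prop :=
  if k is k'.+1 then
    exists z', [/\ nth_cluster e k' z', cluster_below e z, z != z', below z z' &
      forall y, cluster_below e y -> y != z' -> below y z' -> below y z]
  else cluster_below e z /\ forall y, cluster_below e y -> below y z.

(** The trace that the letters [(m, n)] leave on the topology: their legs end near
    the highest cluster point of a leg, and start clustering [m + 1] places
    further down. *)
Definition clusters_jump m := exists e z0 z (d a : nat -> X),
  [/\ is_tip e, nth_cluster e 0 z0, nth_cluster e m.+1 z,
      forall n, is_tip (d n) /\ nth_cluster (d n) 0 (a n) &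
      d n @[n --> \oo] --> z0 /\ a n @[n --> \oo] --> z].

End OrderInvariants.

Section Transport.
Context {R : realType}.

Section ArcTransport.
Context {X Y : metricType R} (h : X -> Y) (g : Y -> X).
Context (hK : cancel h g) (ch : continuous h) (cg : continuous g).

Lemma continuum_image K : is_continuum K -> is_continuum (h @` K).
Proof.
move=> [K0 cK nK]; split; first exact/image_nonempty.
  by apply: continuous_compact => //; exact: continuous_subspaceT.
by apply: connected_continuous_connected => //; exact: continuous_subspaceT.
Qed.

Lemma arc_image A x y : arc_between A x y -> arc_between (h @` A) (h x) (h y).
Proof.
move=> [f [f' [fA cf cf' fK [f0 f1]]]]; exists (h \o f), (f' \o g); split.
- by rewrite -fA image_comp.
- by move=> r; apply: (@continuous_comp (subspace _) _ _ f h r); [exact: cf|exact: ch].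
- apply/subspace_continuousP => _ [a Aa <-].
  move/subspace_continuousP : cf' => /(_ a Aa).
  rewrite /from_subspace /= hK => cf' U /cf' UA.
  have /cg UB : nbhs (g (h a)) (fun t => A t -> U (f' t)) by rewrite hK; exact: UA.
  apply: (@filterS _ (nbhs (h a)) _ _ _ _ UB) => y' Uy [b Ab yE].
  by apply: Uy; rewrite -yE hK.
- by move=> r r01 /=; rewrite hK fK.
- by rewrite /= f0 f1.
Qed.

Lemma triod_top_image s : simple_triod_top s -> simple_triod_top (h s).
Proof.
move=> [A [B [C [a [b [c [[hA hB hC] AB AC BC]]]]]]].
have meet (S T : set X) : S `&` T = [set s] -> h @` S `&` h @` T = [set h s].
  move=> E; rewrite -(image_set1 h) -E; apply/seteqP.
  split=> [_ [[x Sx <-] [y Ty]]|_ [x [Sx Tx] <-]].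
    by move=> yx; exists x => //; split=> //; rewrite -(can_inj hK yx).
  by split; exists x.
exists (h @` A), (h @` B), (h @` C), (h a), (h b), (h c).
by split; [split; apply: arc_image|apply: meet|apply: meet|apply: meet].
Qed.
End ArcTransport.

Definition inverse_homeos (X Y : topologicalType) (h : X -> Y) (g : Y -> X) :=
  [/\ cancel h g, cancel g h, continuous h & continuous g].

Lemma inverse_homeosC (X Y : topologicalType) (h : X -> Y) (g : Y -> X) :
  inverse_homeos h g -> inverse_homeos g h.
Proof. by case. Qed.

Lemma homeo_top (M N : pred nat) (h : fan R M -> fan R N) g :
  inverse_homeos h g -> h top = top.
Proof.
move=> [hK gK ch cg].
by apply: triod_top_unique; apply: (triod_top_image hK ch cg); exact: triod_top_top.
Qed.

Lemma homeo_below (M N : pred nat) (h : fan R M -> fan R N) g :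
  inverse_homeos h g -> forall p q, below (h p) (h q) = below p q.
Proof.
suff sub (M' N' : pred nat) (k : fan R M' -> fan R N') l :
    inverse_homeos k l -> forall p q, below p q -> below (k p) (k q).
  move=> hg p q; apply/idP/idP; last exact: sub hg _ _.
  have [hK _ _ _] := hg.
  by move/(sub _ _ _ _ (inverse_homeosC hg)); rewrite !hK.
move=> hg p q pq; have [hK gK ch cg] := hg.
(* [l] maps the segment from the top to [k q] onto a continuum containing the
   top and [q]; by convexity that continuum contains [p] *)
have cS := continuum_image cg (seg_continuum top (k q)).
have Sp : seg top q p by rewrite seg_topE.
have [||y] := continuum_convex cS (p := top) (q := q) _ _ Sp.
- by exists top; [exact: seg_left|rewrite -(homeo_top hg) hK].
- by exists (k q); [exact: seg_right|rewrite hK].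
- by rewrite seg_topE => /= yq <-; rewrite gK.
Qed.

Lemma homeo_tip (M N : pred nat) (h : fan R M -> fan R N) g e :
  inverse_homeos h g -> is_tip e -> is_tip (h e).
Proof.
move=> hg [e0 em]; have [hK gK _ _] := hg; split=> [|p].
  by rewrite -(homeo_top hg) (inj_eq (can_inj hK)).
by rewrite -(gK p) (homeo_below hg) => /em ->.
Qed.

Lemma homeo_cluster_below (M N : pred nat) (h : fan R M -> fan R N) g e z :
  inverse_homeos h g -> cluster_below e z -> cluster_below (h e) (h z).
Proof.
move=> hg [z0 zl ze]; have [hK gK ch _] := hg; have hI := can_inj hK.
split; [by rewrite -(homeo_top hg) (inj_eq hI)| |by rewrite (homeo_below hg)].
move=> U /ch/zl[y [yz ty Uy]]; exists (h y); split => //.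
  by rewrite (inj_eq hI).
exact: homeo_tip hg ty.
Qed.

Section ClusterTransport.
Context {M N : pred nat} (h : fan R M -> fan R N) (g : fan R N -> fan R M).
Context (hg : inverse_homeos h g).

Lemma homeo_cluster_belowV e y : cluster_below (h e) y -> cluster_below e (g y).
Proof.
have [hK _ _ _] := hg.
by move/(homeo_cluster_below (inverse_homeosC hg)); rewrite hK.
Qed.

Lemma homeo_nth_cluster e k z : nth_cluster e k z -> nth_cluster (h e) k (h z).
Proof.
have [hK gK _ _] := hg; elim: k z => [|k IH] z /=.
  move=> [ez zm]; split; first exact: homeo_cluster_below hg ez.
  by move=> y /homeo_cluster_belowV/zm; rewrite -(homeo_below hg) gK.
move=> [z' [ez' ez zz' zz'b zm]]; exists (h z'); split.
- exact: IH.
- exact: homeo_cluster_below hg ez.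
- by rewrite (inj_eq (can_inj hK)).
- by rewrite (homeo_below hg).
move=> y ey yz' yz'b; have := zm _ (homeo_cluster_belowV ey).
rewrite -!(homeo_below hg) gK; apply=> //.
by apply: contraNneq yz' => <-; rewrite gK.
Qed.

Lemma homeo_clusters_jump m :
  @clusters_jump R M m -> @clusters_jump R N m.
Proof.
have [_ _ ch _] := hg.
move=> [e [z0 [z [d [a [te ez0 ez da [dz0 az]]]]]]].
exists (h e), (h z0), (h z), (h \o d), (h \o a); split.
- exact: homeo_tip hg te.
- exact: homeo_nth_cluster ez0.
- exact: homeo_nth_cluster ez.
- by move=> n; have [dn an] := da n; split; [exact: homeo_tip hg dn|exact: homeo_nth_cluster].
- by split; [apply: continuous_cvg dz0; exact: ch|apply: continuous_cvg az; exact: ch].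
Qed.
End ClusterTransport.
End Transport.

(** ** The clusters on a leg *)

Section Clusters.
Context {R : realType} {M : pred nat}.
Local Notation X := (fan R M).
Local Notation len := (@leg_len R M).
Implicit Types (e p q y z : X).

Lemma below_anti p q : below p q -> below q p -> p = q.
Proof.
move=> pq qp; have e : ht p = ht q by apply: le_anti; rewrite !below_ht.
have [p0|p0] := eqVneq p top.
  by apply/eqP; rewrite p0 eq_sym -ht_eq0 -e p0 ht_top.
by apply: fan_eq e; rewrite (below_leg pq).
Qed.

Lemma is_tipP e : is_tip e <-> exists2 w, admissible M w & e = tip w.
Proof.
split=> [[e0 em]|[w wM ->]].
  have lM : admissible M (leg e).
    by rewrite -(@len_gt0 R); apply: lt_le_trans (ht_le e); rewrite ht_gt0.
  exists (leg e) => //; apply/esym/em; have [l h] := @tipE R M _ lM.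
  by rewrite /below l h eqxx ht_le orbT.
split=> [|p wp]; first exact: tip_neq_top.
have [l h] := @tipE R M _ wM; apply/esym/(below_anti wp).
have lp := below_leg wp (tip_neq_top wM).
by rewrite /below -lp l h eqxx -{1}l lp ht_le orbT.
Qed.

Lemma pow2_isolated (x : R) : 0 < x ->
  exists2 e : R, 0 < e & forall k, `|x - 2^-1 ^+ k| < e -> 2^-1 ^+ k = x.
Proof.
move=> x0; have [|n hn] := @pow2_small R (x / 2); first by rewrite divr_gt0.
suff [e e0 he] : exists2 e : R, 0 < e &
    forall k, (k < n)%N -> `|x - 2^-1 ^+ k| < e -> 2^-1 ^+ k = x.
  exists (Num.min e (x / 2)); first by rewrite lt_min e0 divr_gt0.
  move=> k; rewrite lt_min => /andP[ke kx].
  have [kn|nk] := ltnP k n; first exact: he.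
  by move: kx; rewrite ltr_norml => /andP[_]; have := pow2_le (R := R) nk; lra.
elim: n {hn} => [|n [e e0 he]]; first by exists 1.
have [nx|nx] := eqVneq (2^-1 ^+ n) x.
  exists e => // k; rewrite ltnS leq_eqVlt => /orP[/eqP->//|]; exact: he.
have xn : 0 < `|x - 2^-1 ^+ n| by rewrite normr_gt0 subr_eq0 eq_sym.
exists (Num.min e `|x - 2^-1 ^+ n|); first by rewrite lt_min e0.
move=> k; rewrite ltnS leq_eqVlt lt_min => /orP[/eqP->|kn] /andP[ke kx].
  by rewrite ltxx in kx.
exact: he.
Qed.

Lemma pow2_inj : injective (fun n => 2^-1 ^+ n : R).
Proof.
move=> m n; wlog mn : m n / (m <= n)%N.
  by move=> wl e; case/orP: (leq_total m n) => h; [|apply/esym]; apply: wl.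
move=> e; apply/eqP; rewrite eqn_leq mn /= leqNgt; apply/negP => mn'.
have : 2^-1 ^+ n < 2^-1 ^+ m :> R by rewrite ltr_iXn2l//; lra.
by rewrite -e ltxx.
Qed.

Definition level w j : X := pt w (2^-1 ^+ (cost w + j.+1)).

Lemma levelE w j : admissible M w ->
  leg (level w j) = w /\ ht (level w j) = 2^-1 ^+ (cost w + j.+1).
Proof.
move=> wM; apply: ptE; rewrite exprn_gt0//= /leg_len wM pow2_le//.
by have := depth_le_cost w; lia.
Qed.

Lemma level_neq_top w j : admissible M w -> level w j != top.
Proof. by move=> wM; rewrite -ht_gt0 (levelE j wM).2 exprn_gt0. Qed.

Lemma below_level w i j : admissible M w ->
  below (level w i) (level w j) = (j <= i)%N.
Proof.
move=> wM; rewrite /below (negbTE (level_neq_top i wM)) /=.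
have [-> ->] := levelE i wM; have [-> ->] := levelE j wM.
rewrite eqxx /= ler_iXn2l ?leq_add2l//; lra.
Qed.

Lemma below_level_tip w j : admissible M w -> below (level w j) (tip w).
Proof.
move=> wM; rewrite /below; have [-> ->] := levelE j wM.
have [-> ->] := @tipE R M _ wM.
rewrite eqxx /leg_len wM pow2_le ?orbT//.
by have := depth_le_cost w; lia.
Qed.

(** A word [u] that is not a prefix of [w] is a prefix of [w ++ (m, n) :: v] for at
    most one [n]. *)
Lemma child_cvg w m v z (f : nat -> X) :
  leg z = w -> (forall n, leg (f n) = w ++ (m, n) :: v) ->
  (forall n, ht (f n) = ht z) -> f n @[n --> \oo] --> z.
Proof.
move=> zw fl fh; apply: cvg_leg => [|u].
  by under eq_fun do rewrite fh; exact: cvg_cst.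
rewrite zw; have [uw|nuw] := boolP (prefix u w).
  by apply: nearW => n; rewrite fl prefix_catl.
exists (nth (0, 0)%N u (size w)).2.+1 => // n /= un; apply/negbTE.
rewrite fl; apply/negP => uv; have := prefix_linear uv (prefix_prefix w _).
rewrite (negbTE nuw) /= => /prefixP[u' uE]; move: un uv nuw; rewrite uE.
rewrite nth_cat ltnn subnn prefix_catr// eqxx /=.
case: u' {uE} => [|b u'] /=; first by rewrite cats0 prefix_refl.
by move=> bn /andP[/eqP be _]; rewrite be /= ltnn in bn.
Qed.

(** Tips have heights of the form [2^-k], which only accumulate at [0]; so tips
    close to [z] have the height of [z], and they lie on legs that properly
    extend [w].  Conversely the letters with [m = 0] produce tips at all levels. *)
Lemma cluster_belowP w z : admissible M w ->
  cluster_below (tip w) z <-> exists j, z = level w j.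
Proof.
move=> wM; have [lw hw] := @tipE R M _ wM; split=> [[z0 zl zw]|[j ->]].
  have lz : leg z = w by rewrite (below_leg zw).
  have z_gt0 : 0 < ht z by rewrite ht_gt0.
  have [e e0 he] := pow2_isolated z_gt0.
  have /zl[d [dz td []]] : nbhs z [set d | prefix w (leg d) /\ `|ht z - ht d| < e].
    near=> d; split; near: d.
      by apply: filterS (near_leg w z0) => d /= ->; rewrite lz prefix_refl.
    by have /cvgrPdist_lt/(_ _ e0) := ht_continuous z.
  move: td dz => /is_tipP[v vM ->]; have [lv hv] := @tipE R M _ vM.
  rewrite lv hv => vz /prefixP[v' vE]; rewrite /leg_len vM => /he hz.
  have v'0 : v' != [::].
    apply: contraNneq vz => v'0; move: vE; rewrite v'0 cats0 => vE.
    apply/eqP; apply: fan_eq; first by rewrite lv lz.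
    by rewrite hv /leg_len vM.
  exists (depth v').-1; have [ll hl] := levelE (depth v').-1 wM.
  apply: fan_eq; first by rewrite lz.
  rewrite hl -hz vE depth_cat// prednK//.
  by have := size_le_depth v'; case: (v') v'0 => //= ? ? _; lia.
have [lj hj] := levelE j wM; split; [exact: level_neq_top| |exact: below_level_tip].
pose v n : word := w ++ (0%N, n) :: nseq j (0, 0)%N.
have vM n : admissible M (v n).
  by rewrite admissible_cat wM /=; elim: j {lj hj v}.
have vc : tip (v n) @[n --> \oo] --> level w j.
  apply: (@child_cvg w 0%N (nseq j (0, 0)%N)) => // n; have [ln hn] := @tipE R M _ (vM n).
    by rewrite ln.
  rewrite hn hj /leg_len vM depth_cat//; congr (_ ^+ (_ + _)).
  rewrite /depth /cost /= map_nseq sumn_nseq mul1n add1n.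
  suff -> : (last (0, n) (nseq j (0, 0)) = (0, if j is 0 then n else 0))%N by rewrite subn0.
  by case: (j) => // i; elim: i => //=.
move=> U /vc [n _ /(_ n (leqnn n))] /= Un; exists (tip (v n)); split=> //.
  apply/eqP => /(congr1 leg); rewrite lj (tipE (vM n)).1 /v => /(congr1 size).
  by rewrite size_cat /=; lia.
by apply/is_tipP; exists (v n).
Unshelve. all: by end_near. Qed.

Lemma nth_clusterP w k z : admissible M w ->
  nth_cluster (tip w) k z <-> z = level w k.
Proof.
move=> wM; elim: k z => [|k IH] z /=.
  split=> [[/(cluster_belowP _ wM)[j ->] zm]|->].
    apply: below_anti; first by rewrite below_level.
    by apply: zm; apply/cluster_belowP => //; exists 0%N.
  split=> [|y /(cluster_belowP _ wM)[j ->]]; last by rewrite below_level.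
  by apply/cluster_belowP => //; exists 0%N.
split=> [[z' [/IH -> /(cluster_belowP _ wM)[j ->] jk bjk zm]]|->].
  rewrite below_level// in bjk.
  have kj : (k < j)%N by rewrite ltn_neqAle bjk andbT; apply: contraNneq jk => ->.
  apply: below_anti; first by rewrite below_level.
  apply: zm.
  - by apply/cluster_belowP => //; exists k.+1.
  - apply/eqP => e; have := below_level k k.+1 wM.
    by rewrite -e below_level// leqnn ltnn.
  - by rewrite below_level.
have neq i j : i != j -> level w i != level w j.
  apply: contraNneq => e; have := below_level i j wM; have := below_level j i wM.
  by rewrite -e below_level// leqnn => /esym ij /esym ji; rewrite eqn_leq ij ji.
exists (level w k); split.
- exact/IH.
- by apply/cluster_belowP => //; exists k.+1.
- by apply: neq; lia.
- by rewrite below_level.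
move=> y /(cluster_belowP _ wM)[j ->] jk; rewrite !below_level// => kj.
by rewrite ltn_neqAle kj andbT; apply: contraNneq jk => ->.
Qed.

(** If tips tend to the highest cluster point of the leg [w], their legs extend [w],
    and eventually they have height [2^-(cost w + 1)]; this leaves only the words
    [rcons w (x, x')].  Their highest cluster points then tell [x]. *)
Lemma clusters_jumpP m : @clusters_jump R M m <-> allowed M m.
Proof.
split=> [[e [z0 [z [d [a [te ez0 ez da [dz0 az]]]]]]]|mM].
  move: te ez0 ez => /is_tipP[w wM ->] /(nth_clusterP _ _ wM) z0E /(nth_clusterP _ _ wM) zE.
  have [l0 h0] := levelE 0 wM; have [lz hz] := levelE m.+1 wM.
  have z0_gt0 : 0 < ht z0 by rewrite ht_gt0 z0E level_neq_top.
  have z_gt0 : 0 < ht z by rewrite ht_gt0 zE level_neq_top.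
  have [e0 e0_gt0 he0] := pow2_isolated z0_gt0.
  have [e1 e1_gt0 he1] := pow2_isolated z_gt0.
  have htc (f : nat -> X) p : f n @[n --> \oo] --> p -> ht (f n) @[n --> \oo] --> ht p.
    by move=> fp; apply: continuous_cvg fp; exact: ht_continuous.
  have n1 : \forall n \near \oo, prefix w (leg (d n)).
    have nz0 : \forall p \near z0, prefix w (leg p) = prefix w (leg z0).
      by apply: near_leg; rewrite -ht_gt0.
    by apply: (@filterS _ \oo _ _ _ _ (dz0 _ nz0)) => n /= ->; rewrite z0E l0 prefix_refl.
  have /cvgrPdist_lt/(_ _ e0_gt0) n2 := htc _ _ dz0.
  have /cvgrPdist_lt/(_ _ e1_gt0) n3 := htc _ _ az.
  have [n [[wd hd] ha]] := filter_ex (filterI (filterI n1 n2) n3).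
  have [/is_tipP[v vM dv]] := da n; rewrite dv => /(nth_clusterP _ _ vM) an.
  move: wd hd ha; rewrite dv an; have [-> ->] := @tipE R M _ vM.
  have [_ ->] := levelE 0 vM; rewrite {1}/leg_len vM => /prefixP[v' vE] /he0 hd /he1 ha.
  move: hd ha; rewrite z0E zE h0 hz => /pow2_inj hd /pow2_inj ha.
  case/lastP: v' vE => [|r [x x']] vE.
    by move: hd; rewrite vE cats0; have := depth_le_cost w; lia.
  move: hd ha; rewrite vE depth_cat ?depth_rcons; last by case: (r).
  rewrite cost_cat cost_rcons /= => hd ha.
  have r0 : cost r = 0%N by lia.
  have -> : m = x by lia.
  by move: vM; rewrite vE admissible_cat /admissible all_rcons => /andP[_ /andP[]].
have nM : admissible M [::] by [].
have mnM n : admissible M [:: (m, n)] by rewrite /admissible /= mM.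
exists (tip [::]), (level [::] 0), (level [::] m.+1), (fun n => tip [:: (m, n)]),
  (fun n => level [:: (m, n)] 0); split.
- by apply/is_tipP; exists [::].
- exact/nth_clusterP.
- exact/nth_clusterP.
- move=> n; split; first by apply/is_tipP; exists [:: (m, n)].
  exact/nth_clusterP.
split; apply: (@child_cvg [::] m [::]).
- by rewrite (levelE _ nM).1.
- by move=> n; rewrite (tipE (mnM n)).1.
- by move=> n; rewrite (tipE (mnM n)).2 (levelE _ nM).2 /leg_len mnM (depth_rcons [::]).
- by rewrite (levelE _ nM).1.
- by move=> n; rewrite (levelE _ (mnM n)).1.
- by move=> n; rewrite (levelE _ (mnM n)).2 (levelE _ nM).2 /cost /=; congr (_ ^+ _); lia.
Qed.
End Clusters.

(** * Uncountably many fans *)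

Lemma uncountable_pred : ~ countable [set: nat -> bool].
Proof.
move=> /countable_injP[f finj].
pose b n := `[< exists c : nat -> bool, f c = n /\ c n = false >].
have /negP : ~~ b (f b).
  apply/negP => /[dup] bT /asboolP[c [fc]].
  by rewrite (finj c b) ?bT ?inE.
apply; case E : (b (f b)) => //.
by move: (E) => /asboolP; case; exists b.
Qed.

Lemma homeomorphic_fan (R : realType) (M N : pred nat) :
  homeomorphic (fan R M) (fan R N) -> M =1 N.
Proof.
move=> [h [g hg]] m; apply/idP/idP => Mm.
  have /clusters_jumpP : @clusters_jump R N m.+1; last by [].
  by apply: (homeo_clusters_jump hg); apply/clusters_jumpP.
have /clusters_jumpP : @clusters_jump R M m.+1; last by [].
by apply: (homeo_clusters_jump (inverse_homeosC hg)); apply/clusters_jumpP.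
Qed.

Theorem theorem5p5 (R : realType) :
  exists (I : Type) (F : I -> metricType R),
    [/\ ~ countable [set: I],
        (forall i : I, smooth_fan (F i) /\ endpoint_homogeneous (F i)) &
        (forall i j : I, i <> j -> ~ homeomorphic (F i) (F j))].
Proof.
exists (nat -> bool), (fun M => fan R M : metricType R); split.
- exact: uncountable_pred.
- by move=> M; split; [exact: fan_smooth_fan|exact: fan_endpoint_homogeneous].
- by move=> M N MN /homeomorphic_fan h; apply: MN; apply/funext.
Qed.
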